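(* Let $\mu>1$, $\lambda>0$, let $F(p)=\Phi_\mu(|p|)$ for $p\in\mathbb{R}$, and let $f:[0,1]\to[0,1]$ be given by $f(t)=0$ for $0\le t\le\frac12$ and $f(t)=1$ for $\frac12<t\le1$. Let $u\in BV(0,1)$ denote the unique minimizer of $K$ in $BV(0,1)$ (which is of class $C^2([0,1]\setminus\{\frac12\})$). If $\mu>2$ and $$\lambda>\frac{8}{\mu-2},$$ then $$\sup_{0\le t<1/2}u(t)<\frac12<\inf_{1/2<t\le1}u(t),$$ which means that $u$ has a jump discontinuity at $t=\frac12$.
   Context: For $\mu>1$, $\Phi_\mu(r):=\int_0^r\int_0^s(1+t)^{-\mu}\,dt\,ds$ for $r\ge0$. For $F(p)=\Phi_\mu(|p|)$ one has $\lambda_\infty:=\lim_{p\to\infty}F'(p)=\frac1{\mu-1}$. For $w\in BV(0,1)$ write the distributional derivative as $Dw=\dot w\,\mathcal{L}^1+D^sw$ (Lebesgue decomposition with respect to Lebesgue measure $\mathcal{L}^1$; $\dot w$ is the density of the absolutely continuous part and $D^sw$ the singular part, $|D^sw|$ its total variation measure), and $$K[w]:=\int_0^1F(\dot w)\,dt+\lambda_\infty|D^sw|(0,1)+\frac{\lambda}{2}\int_0^1(w-f)^2\,dt.$$ Every $BV$-function is identified with its good representative, which is continuous outside an at most countable set of jump points and has left and right limits at all points. *)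

(* Defs.v *)
From HB Require Import structures.
From mathcomp Require Import all_boot all_order all_algebra.
From mathcomp Require Import all_classical all_reals all_analysis.
Import Order.TTheory GRing.Theory Num.Theory.
Import numFieldNormedType.Exports.

Set Implicit Arguments.
Unset Strict Implicit.
Unset Printing Implicit Defensive.

Local Open Scope classical_set_scope.
Local Open Scope ring_scope.

Section Density.
Context {R : realType}.
Implicit Types (m p r : R).

Definition Phi m r : R :=
  \int[lebesgue_measure]_(s in `[0, r])
    \int[lebesgue_measure]_(t in `[0, s]) (1 + t) `^ (- m).

Definition F m p : R := Phi m `|p|.

Definition lambda_infty m : R := lim (derive1 (F m) p @[p --> +oo]).

End Density.

Section Charges.
Context {d : measure_display} {T : measurableType d} {R : realType}.
Implicit Types nu : {charge set T -> \bar R}.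

(* The Jordan decomposition does not depend on the Hahn decomposition that is
   chosen here. *)
Definition hahn_sets nu : {PN : set T * set T | hahn_decomposition nu PN.1 PN.2}.
Proof.
apply: cid; have [P [N PN]] := Hahn_decomposition nu.
by exists (P, N).
Qed.

Definition pos_part nu : {measure set T -> \bar R} :=
  jordan_pos (svalP (hahn_sets nu)).

Definition neg_part nu : {measure set T -> \bar R} :=
  jordan_neg (svalP (hahn_sets nu)).

Definition tot_var nu (A : set T) : \bar R :=
  charge_variation (svalP (hahn_sets nu)) A.

Definition charge_integral nu (A : set T) (f : T -> R) : \bar R :=
  (\int[pos_part nu]_(x in A) (f x)%:E - \int[neg_part nu]_(x in A) (f x)%:E)%E.

End Charges.

Section BV.
Context {R : realType}.
Implicit Types (w g phi f : R -> R).

Local Notation leb := (@lebesgue_measure R).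
Local Notation I01 := (`]0, 1[%classic : set R).
Local Notation chargeR := (charge (measurableTypeR R) R).

Definition test_function phi : Prop :=
  [/\ forall x, derivable phi x 1,
      continuous (derive1 phi)
    & exists a b : R, [/\ 0 < a, b < 1
        & forall x, x \notin `[a, b] -> phi x = 0]].

(* A charge lives on the Borel sets of the whole line; only its values on the
   Borel subsets of ]0, 1[ matter below. *)
Definition distributional_derivative w (nu : chargeR) : Prop :=
  forall phi, test_function phi ->
    (\int[leb]_(x in I01) (w x * derive1 phi x)%:E = - charge_integral nu I01 phi)%E.

Definition BV w : Prop :=
  leb.-integrable I01 (EFin \o w) /\
  exists nu : chargeR, distributional_derivative w nu.

Definition singular_on01 (nu : chargeR) : Prop :=
  exists N : set R, [/\ measurable N, N `<=` I01, leb N = 0%E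
    & tot_var nu (I01 `\` N) = 0%E].

Definition lebesgue_decomposition (nu : chargeR) g (nus : chargeR) : Prop :=
  [/\ leb.-integrable I01 (EFin \o g), singular_on01 nus
    & forall A : set R, measurable A -> A `<=` I01 ->
        (nu A = \int[leb]_(x in A) (g x)%:E + nus A)%E].

Definition derivative_parts w (D : (R -> R) * chargeR) : Prop :=
  exists nu : chargeR,
    distributional_derivative w nu /\ lebesgue_decomposition nu D.1 D.2.

(* The two parts are unique up to a Lebesgue null set (density) and on the
   Borel subsets of ]0, 1[ (singular part); they are selected by classical
   choice, with a dummy value when w is not BV. *)
Definition derivative_pair w : (R -> R) * chargeR :=
  if pselect (exists D, derivative_parts w D) is left h
  then sval (cid h) else (cst 0, czero : chargeR).

Definition ac_density w : R -> R := (derivative_pair w).1.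

Definition singular_part w : chargeR := (derivative_pair w).2.

Definition K m lam f w : \bar R :=
  (\int[leb]_(t in I01) (F m (ac_density w t))%:E
   + (lambda_infty m)%:E * tot_var (singular_part w) I01
   + (lam / 2)%:E * \int[leb]_(t in I01) ((w t - f t) ^+ 2)%:E)%E.

Definition minimizer m lam f w : Prop :=
  BV w /\ forall v, BV v -> (K m lam f w <= K m lam f v)%E.

Definition jump w (t : R) : Prop :=
  [/\ 0 < t < 1, cvg (w x @[x --> t^'-]), cvg (w x @[x --> t^'+])
    & lim (w x @[x --> t^'-]) <> lim (w x @[x --> t^'+])].

(* Representatives are functions on [0, 1] (values outside are irrelevant).
   At the endpoints, which are never jump points, the last clause says that
   w 0 and w 1 are the one-sided limits; at a jump point the value of w is
   left unconstrained. *)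
Definition good_representative w : Prop :=
  [/\ forall t : R, 0 <= t < 1 -> cvg (w x @[x --> t^'+]),
      forall t : R, 0 < t <= 1 -> cvg (w x @[x --> t^'-]),
      countable [set t | jump w t]
    & forall t : R, 0 <= t <= 1 -> ~ jump w t ->
        w x @[x --> within `[0, 1] (nbhs t)] --> w t].

Definition step_data (t : R) : R := if t <= 1 / 2 then 0 else 1.

End BV.

(* Main.v *)
Require Import Defs.
From HB Require Import structures.
From mathcomp Require Import all_boot all_order all_algebra.
From mathcomp Require Import all_classical all_reals all_analysis.
From mathcomp Require Import measurable_realfun ring lra.
Import Order.TTheory GRing.Theory Num.Theory.
Import numFieldNormedType.Exports.
Set Implicit Arguments.
Unset Strict Implicit.
Unset Printing Implicit Defensive.

Local Open Scope classical_set_scope.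
Local Open Scope ring_scope.

(** The quadratic term makes the energy strictly convex, so it is enough to
    exhibit one minimizer [v] with values below [1/2] on the left half and above
    [1/2] on the right half, and to show that every minimizer agrees with it
    almost everywhere.

    Write [L = 1 / (mu - 1)] for the asymptotic slope of the density, [H] for the
    convex conjugate of the density on [[0, L]] ([fconj]) and [G = H']
    ([inv_slope]).  On the left half
    the candidate solves the Euler--Lagrange system [sigma' = lam v],
    [v' = G sigma] with [sigma 0 = 0] and [sigma (1/2) = L]; on the right half it
    is continued by [v (1 - t) = 1 - v t] and [sigma (1 - t) = sigma t].  The
    first integral [lam (v ^ 2 - a ^ 2) = 2 H sigma], where [a = v 0], reduces the
    system to a quadrature: the time that [sigma] needs to reach [L] is a
    continuous function of [a], infinite in the limit [a = 0] and at most [1/2]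
    for [a = 2 L / lam], so that some [a] in between gives [1/2] ([shooting]).
    For [mu > 2] the conjugate is bounded by [1 / ((mu - 1) (mu - 2))], so [v] is
    bounded on the left half by the square root of
    [a ^ 2 + 2 / (lam (mu - 1) (mu - 2))]; the hypothesis on [lam] makes this
    smaller than [1/2] ([amplitude_bound], [profile]).

    That [v] is minimal is a calibration argument with the dual field [sigma].
    For every [w] of bounded variation Fenchel's inequality bounds the density
    term below by the integral of [sigma w' - H sigma], and [0 <= sigma <= L]
    bounds the singular term below by the integral of [sigma] against the
    singular part.  The two integrals of [sigma] add up to the pairing of
    [sigma] with the derivative of [w], which is the integral of
    [- lam w (v - f)].  Completing the square, the energy of [w] exceeds a
    constant by [lam / 2] times the squared distance of [w] to [v]
    ([energy_lower_bound]).  All inequalities are equalities for [v], because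
    [v' = G sigma] and because its jump sits where [sigma = L] ([energy_cand]).
    Hence a minimizer equals [v] almost everywhere ([minimizer_cand]), and its
    good representative has the one-sided limits of [v].

    Two facts of measure theory support this.  The energy is defined through some
    choice of density and singular part, so both existence
    ([lebesgue_decomposition_exists]) and uniqueness of these parts are needed;
    uniqueness rests on [charge_ext], by which test functions determine a charge
    on the Borel subsets of the interval.  And [sigma] is not a test function, so
    that its pairing with a derivative is obtained by approximation
    ([dual_pairing]). *)

(** * Calculus on an interval *)

Section FTC.
Context {R : realType}.
Local Notation leb := (@lebesgue_measure R).

Lemma within_continuous (f : R -> R) (A : set R) :
  (forall x, A x -> {for x, continuous f}) -> {within A, continuous f}.
Proof.
move=> cf; apply/subspace_continuousP => x Ax.
by apply: (@cvg_trans _ (f @ nbhs x)); [apply: cvg_app; exact: cvg_within|exact: cf].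
Qed.

Lemma Rintegral_FTC2 (f G : R -> R) (a b : R) : a <= b ->
  (forall x, a <= x <= b -> {for x, continuous f}) ->
  (forall x, a <= x <= b -> is_derive x 1 G (f x)) ->
  \int[leb]_(x in `[a, b]) f x = G b - G a.
Proof.
rewrite le_eqVlt => /predU1P[<- _ _|ab cf dG].
  by rewrite set_itv1 Rintegral_set1 subrr.
have cG x : a <= x <= b -> {for x, continuous G}.
  by move=> xab; apply/differentiable_continuous/derivable1_diffP; case: (dG x xab).
rewrite /Rintegral (@continuous_FTC2 _ f G)//.
- by apply: within_continuous => x; rewrite /= in_itv/=; exact: cf.
- split.
  + by move=> x; rewrite in_itv/= => /andP[/ltW ax /ltW xb]; case: (dG x); rewrite ?ax ?xb.
  + by apply: cvg_at_right_filter; apply: cG; rewrite lexx ltW.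
  + by apply: cvg_at_left_filter; apply: cG; rewrite lexx ltW.
- move=> x; rewrite in_itv/= => /andP[/ltW ax /ltW xb].
  have dGx : is_derive x 1 G (f x) by apply: dG; rewrite ax xb.
  by rewrite derive1E derive_val.
Qed.

Lemma is_derive_continuous (f : R -> R) (x l : R) :
  is_derive x 1 f l -> {for x, continuous f}.
Proof. by case=> df _; apply/differentiable_continuous/derivable1_diffP. Qed.

Lemma derive_eq (f : R -> R) (x a b : R) : is_derive x 1 f a -> a = b ->
  is_derive x 1 f b.
Proof. by move=> ? <-. Qed.

Lemma derive_add (f g : R -> R) (x a b : R) :
  is_derive x 1 f a -> is_derive x 1 g b -> is_derive x 1 (fun y => f y + g y) (a + b).
Proof. by move=> df dg; exact: (is_deriveD df dg). Qed.

Lemma derive_sub (f g : R -> R) (x a b : R) :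
  is_derive x 1 f a -> is_derive x 1 g b -> is_derive x 1 (fun y => f y - g y) (a - b).
Proof. by move=> df dg; exact: (is_deriveB df dg). Qed.

Lemma derive_mul (f g : R -> R) (x a b : R) :
  is_derive x 1 f a -> is_derive x 1 g b ->
  is_derive x 1 (fun y => f y * g y) (a * g x + f x * b).
Proof.
move=> df dg; apply: (derive_eq (is_deriveM df dg)).
by rewrite /GRing.scale/= addrC mulrC.
Qed.

Lemma derive_cst (c x : R) : is_derive x 1 (fun=> c) 0.
Proof. exact: is_derive_cst. Qed.

Lemma derive_id (x : R) : is_derive x 1 (fun y : R => y) 1.
Proof. exact: is_derive_id. Qed.

Lemma derive_comp (f g : R -> R) (x a b : R) :
  is_derive (g x) 1 f a -> is_derive x 1 g b ->
  is_derive x 1 (fun y => f (g y)) (a * b).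
Proof. exact: is_derive1_comp. Qed.

End FTC.
Arguments derive_cst {R} c x.
Arguments derive_id {R} x.

Lemma continuous_near_lt {R : realType} (f : R -> R) (t e : R) : continuous f ->
  f t < e -> \forall r \near t, f r < e.
Proof.
move=> cf h; have /cvgrPdist_lt := cf t.
have e0 : 0 < e - f t by rewrite subr_gt0.
move=> /(_ _ e0) h'; near=> r.
have : `|f t - f r| < e - f t by near: r; exact: h'.
by rewrite distrC => /ltr_normlW; rewrite ltrD2r.
Unshelve. all: by end_near. Qed.

Lemma continuous_near_gt {R : realType} (f : R -> R) (t e : R) : continuous f ->
  e < f t -> \forall r \near t, e < f r.
Proof.
move=> cf h; have /cvgrPdist_lt := cf t.
have e0 : 0 < f t - e by rewrite subr_gt0.
move=> /(_ _ e0) h'; near=> r.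
have : `|f t - f r| < f t - e by near: r; exact: h'.
by move=> /ltr_normlW; rewrite ltrD2l ltrN2.
Unshelve. all: by end_near. Qed.

(** * The energy density and its convex conjugate *)

Section Density.
Context {R : realType}.
Local Notation leb := (@lebesgue_measure R).
Implicit Types (m p r s : R).

Definition slope m p : R := (1 - (1 + p) `^ (1 - m)) / (m - 1).

Lemma is_derive_shift_powR (a s : R) : 0 < 1 + s ->
  is_derive s 1 (fun t : R => (1 + t) `^ a) (a * (1 + s) `^ (a - 1)).
Proof.
move=> s0.
apply: derive_eq.
  apply: (@derive_comp _ (fun x => x `^ a) (fun t => 1 + t)).
  exact: is_derive1_powR.
by rewrite add0r !mulr1.
Qed.

Lemma is_derive_slope m s : 1 < m -> 0 < 1 + s ->
  is_derive s 1 (slope m) ((1 + s) `^ (- m)).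
Proof.
move=> m1 s0; apply: derive_eq.
  apply: (derive_mul _ (derive_cst _ s)).
  exact: (derive_sub (derive_cst 1 s) (is_derive_shift_powR (1 - m) s0)).
have -> : 1 - m - 1 = - m by ring.
by field; lra.
Qed.

Lemma inner_integral m s : 1 < m -> 0 <= s ->
  \int[leb]_(t in `[0, s]) (1 + t) `^ (- m) = slope m s.
Proof.
move=> m1 s0.
transitivity (slope m s - slope m 0); last first.
  by rewrite /slope addr0 powR1 subrr mul0r subr0.
apply: Rintegral_FTC2 => //.
- move=> x /andP[x0 _].
  apply: is_derive_continuous; apply: is_derive_shift_powR; lra.
- move=> x /andP[x0 _]; apply: is_derive_slope => //; lra.
Qed.

Definition primitive m r : R :=
  r / (m - 1) - (1 - (1 + r) `^ (2 - m)) / ((m - 1) * (m - 2)).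

Lemma is_derive_primitive m s : 2 < m -> 0 < 1 + s ->
  is_derive s 1 (primitive m) (slope m s).
Proof.
move=> m1 s0; apply: derive_eq.
  apply: derive_sub; apply: (derive_mul _ (derive_cst _ s)).
  exact: (derive_sub (derive_cst 1 s) (is_derive_shift_powR (2 - m) s0)).
rewrite /slope /GRing.scale/=.
have -> : 2 - m - 1 = 1 - m by ring.
by field; apply/andP; split; lra.
Qed.

Lemma Phi_primitive m r : 2 < m -> 0 <= r -> Phi m r = primitive m r.
Proof.
move=> m2 r0; rewrite /Phi.
have -> : \int[leb]_(s in `[0, r]) \int[leb]_(t in `[0, s]) (1 + t) `^ (- m) =
    \int[leb]_(s in `[0, r]) slope m s.
  by apply: eq_Rintegral => s; rewrite inE/= in_itv/= => /andP[s0 _];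
    apply: inner_integral => //; lra.
transitivity (primitive m r - primitive m 0); last first.
  by rewrite /primitive addr0 powR1 subrr !mul0r subrr subr0.
apply: Rintegral_FTC2 => //.
- move=> x /andP[x0 _].
  apply: (@is_derive_continuous _ _ _ ((1 + x) `^ (- m))); apply: is_derive_slope; lra.
- move=> x /andP[x0 _]; apply: is_derive_primitive => //; lra.
Qed.

End Density.
Section Conjugate.
Context {R : realType}.
Implicit Types (m p r s : R).

Lemma F_nng m p : 2 < m -> 0 <= p -> F m p = primitive m p.
Proof. by move=> m2 p0; rewrite /F ger0_norm// Phi_primitive. Qed.

Lemma derive1_F m p : 2 < m -> 0 < p -> derive1 (F m) p = slope m p.
Proof.
move=> m2 p0; rewrite derive1E.
rewrite (@near_eq_derive _ _ _ _ (primitive m))//; last first.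
  near=> q; rewrite F_nng//; apply: ltW.
  by near: q; exact: lt_nbhsr.
by apply: (@derive_val _ _ _ _ _ _ _ (is_derive_primitive _ _)) => //; lra.
Unshelve. all: by end_near. Qed.

Lemma lambda_inftyE m : 2 < m -> lambda_infty m = (m - 1)^-1.
Proof.
move=> m2; apply: cvg_lim => //.
have -> : (m - 1)^-1 = (1 - 0) / (m - 1) by rewrite subr0 div1r.
apply: (@cvg_trans _ ((slope m) p @[p --> +oo])).
  apply: near_eq_cvg; near=> p; rewrite derive1_F//.
apply: cvgM; last exact: cvg_cst.
apply: cvgB; first exact: cvg_cst.
apply: (@squeeze_cvgr _ _ _ _ (cst 0) (fun p => p^-1)); last 2 first.
- exact: cvg_cst.
- have h : \forall p \near +oo, 0 < (id p : R) by near=> p.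
  exact: ((gtr0_cvgV0 h).2 cvg_id).
near=> p; rewrite powR_ge0/=.
have p0 : 0 < p by [].
apply: (@le_trans _ _ ((1 + p) `^ (- 1))).
  by apply: ler_powR; lra.
rewrite powR_inv1; last lra.
by rewrite lef_pV2 ?posrE; lra.
Unshelve. all: by end_near. Qed.

(** The Legendre conjugate of the density on the interval of admissible
    slopes; the truncation of the base only extends it continuously beyond
    the asymptotic slope. *)
Definition fconj m s : R :=
  (1 - (Num.max 0 (1 - (m - 1) * s)) `^ ((m - 2) / (m - 1))) / (m - 2) - s.

(** The inverse of the derivative of the density, i.e. the derivative of its
    conjugate. *)
Definition inv_slope m s : R := (1 - (m - 1) * s) `^ (- (m - 1)^-1) - 1.

Lemma base_ge0 m s : 2 < m -> s <= (m - 1)^-1 -> 0 <= 1 - (m - 1) * s.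
Proof.
move=> m2; rewrite -(ler_pM2l (x := m - 1)); last lra.
by rewrite divff; lra.
Qed.

Lemma base_gt0 m s : 2 < m -> s < (m - 1)^-1 -> 0 < 1 - (m - 1) * s.
Proof.
move=> m2; rewrite -(ltr_pM2l (x := m - 1)); last lra.
by rewrite divff; lra.
Qed.

Lemma conjE m s (z := (1 - (m - 1) * s) `^ (m - 1)^-1) :
  2 < m -> s <= (m - 1)^-1 ->
  z `^ (m - 1) = 1 - (m - 1) * s /\ fconj m s = (1 - z `^ (m - 2)) / (m - 2) - s.
Proof.
move=> m2 sL; have b0 := base_ge0 m2 sL; split.
  by rewrite /z -powRrM mulVf ?powRr1//; lra.
by rewrite /fconj /z -powRrM [(m - 1)^-1 * _]mulrC max_r.
Qed.

(** The gap in Fenchel's inequality, written with powers of the one number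
    [z] so that Young's inequality becomes visible. *)
Lemma conj_gap m s p (z := (1 - (m - 1) * s) `^ (m - 1)^-1) :
  2 < m -> s <= (m - 1)^-1 -> 0 <= p ->
  F m p - (s * p - fconj m s) =
  ((m - 2) * z `^ (m - 1) * (1 + p) + (1 + p) `^ (2 - m) - (m - 1) * z `^ (m - 2))
    / ((m - 1) * (m - 2)).
Proof.
move=> m2 sL p0; have [] := conjE m2 sL; rewrite -/z => zY ->.
rewrite F_nng// /primitive.
have -> : s = (1 - z `^ (m - 1)) / (m - 1) by rewrite zY; field; lra.
field; apply/andP; split; lra.
Qed.

Lemma young_gap (x k : R) : 1 < x -> 0 <= k ->
  x * k `^ (x - 1) <= (x - 1) * k `^ x + 1.
Proof.
move=> x1 k0.
have x0 : 0 < x by lra.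
have q0 : 0 < x / (x - 1) by rewrite divr_gt0//; lra.
have := conjugate_powR (powR_ge0 k (x - 1)) (ler01 : 0 <= (1 : R)) q0 x0.
rewrite mulr1 powR1 -powRrM.
have -> : (x - 1) * (x / (x - 1)) = x by field; lra.
have h : (x / (x - 1))^-1 + x^-1 = 1 by field; apply/andP; split; lra.
move=> /(_ h); rewrite -(ler_pM2l x0) => /le_trans; apply.
rewrite le_eqVlt; apply/orP; left; apply/eqP; field; apply/andP; split; lra.
Qed.

(** With [k = z (1 + p)] the gap is Young's inequality for the conjugate
    exponents [m - 1] and [(m - 1) / (m - 2)], up to a positive factor. *)
Lemma fenchel m s p : 2 < m -> 0 <= s <= (m - 1)^-1 ->
  s * p - fconj m s <= F m p.
Proof.
move=> m2 /andP[s0 sL].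
have main q : 0 <= q -> s * q - fconj m s <= F m q.
  move=> q0; rewrite -subr_ge0 conj_gap//.
  set z := _ `^ (m - 1)^-1; have z0 : 0 <= z by exact: powR_ge0.
  apply: divr_ge0; last by rewrite mulr_ge0; lra.
  have q1 : 0 < 1 + q by lra.
  have A0 : 0 < (1 + q) `^ (m - 2) by rewrite powR_gt0.
  rewrite -(pmulr_rge0 _ A0).
  have -> : 2 - m = - (m - 2) by ring.
  rewrite powRN.
  have := @young_gap (m - 1) (z * (1 + q)) _ _.
  have -> : m - 1 - 1 = m - 2 by ring.
  rewrite !powRM//; [|lra..].
  have -> : (1 + q) `^ (m - 1) = (1 + q) * (1 + q) `^ (m - 2).
    rewrite -[X in _ = X * _]powRr1 ?ltW// -powRD ?(gt_eqF q1) ?implybT//.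
    by congr (_ `^ _); ring.
  move=> /(_ ltac:(lra) ltac:(by rewrite mulr_ge0// ltW)); rewrite -subr_ge0.
  move=> /le_trans; apply; rewrite le_eqVlt; apply/orP; left; apply/eqP.
  by field; lra.
have [p0|p0] := leP 0 p; first exact: main.
have H0 : 0 <= fconj m s.
  have := main 0 (lexx _); rewrite mulr0 F_nng// /primitive addr0 powR1 subrr !mul0r.
  lra.
have := main (- p); rewrite oppr_ge0 (ltW p0) /F normrN => /(_ isT).
by apply: le_trans; nra.
Qed.

Lemma powR_invl (z m : R) : 0 < z -> z^-1 `^ (2 - m) = z `^ (m - 2).
Proof.
move=> z0; rewrite (_ : z^-1 = z `^ (- 1)); last by rewrite powR_inv1// ltW.
by rewrite -powRrM mulN1r opprB.
Qed.

(** The gap vanishes at [z (1 + p) = 1], the equality case of Young's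
    inequality. *)
Lemma fenchel_eq m s : 2 < m -> 0 <= s < (m - 1)^-1 ->
  F m (inv_slope m s) = s * inv_slope m s - fconj m s.
Proof.
move=> m2 /andP[s0 sL]; have b0 := base_gt0 m2 sL.
set z := (1 - (m - 1) * s) `^ (m - 1)^-1.
have z0 : 0 < z by rewrite powR_gt0.
have z1 : z <= 1.
  rewrite /z -[leRHS](powRr0 (1 - (m - 1) * s)); apply: ger_powR.
    by rewrite b0; nra.
  by rewrite invr_ge0; lra.
have GE : inv_slope m s = z^-1 - 1 by rewrite /inv_slope powRN.
have G0 : 0 <= inv_slope m s by rewrite GE subr_ge0 invf_ge1.
apply/eqP; rewrite -subr_eq0 (conj_gap m2 (ltW sL) G0) -/z GE (_ : 1 + (z^-1 - 1) = z^-1); last by ring.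
have -> : z^-1 `^ (2 - m) = z `^ (m - 2).
  exact: powR_invl.
have -> : z `^ (m - 1) = z * z `^ (m - 2).
  rewrite -[X in _ = X * _]powRr1 ?ltW// -powRD ?(gt_eqF z0) ?implybT//.
  by congr (_ `^ _); ring.
by rewrite mulf_eq0; apply/orP; left; apply/eqP; field; lra.
Qed.

Lemma conj0 m : fconj m 0 = 0.
Proof. by rewrite /fconj mulr0 !subr0 max_r// powR1 subrr mul0r. Qed.

Lemma conj_ge0 m s : 2 < m -> 0 <= s <= (m - 1)^-1 -> 0 <= fconj m s.
Proof.
move=> m2 sL; have := fenchel 0 m2 sL.
rewrite mulr0 F_nng// /primitive addr0 powR1 subrr !mul0r; lra.
Qed.

Lemma conj_le m s : 2 < m -> 0 <= s <= (m - 1)^-1 ->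
  fconj m s <= ((m - 1) * (m - 2))^-1.
Proof.
move=> m2 /andP[s0 sL]; have [zY ->] := conjE m2 sL.
set z := _ `^ (m - 1)^-1 in zY *.
have b0 := base_ge0 m2 sL.
have z0 : 0 <= z by exact: powR_ge0.
have z1 : z <= 1.
  rewrite leNgt; apply/negP => z1.

  have : z <= z `^ (m - 1) by apply: le1r_powR; lra.
  rewrite zY; nra.
have BY : z `^ (m - 1) <= z `^ (m - 2).
  have [->|zn0] := eqVneq z 0; first by rewrite !powR0//; lra.
  by apply: ger_powR; [rewrite lt0r zn0 z0|lra].
have B0 := powR_ge0 z (m - 2).
have -> : s = (1 - z `^ (m - 1)) / (m - 1) by rewrite zY; field; lra.
rewrite -subr_ge0.
have -> : ((m - 1) * (m - 2))^-1 -
   ((1 - z `^ (m - 2)) / (m - 2) - (1 - z `^ (m - 1)) / (m - 1)) =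
   ((m - 1) * z `^ (m - 2) - (m - 2) * z `^ (m - 1)) / ((m - 1) * (m - 2)).
  by field; apply/andP; split; lra.
by rewrite divr_ge0//; nra.
Qed.

Lemma is_derive_conj m s : 2 < m -> s < (m - 1)^-1 ->
  is_derive s 1 (fconj m) (inv_slope m s).
Proof.
move=> m2 sL; have b0 := base_gt0 m2 sL.
apply: (@near_eq_is_derive _ _ _
  (fun s => (1 - (1 - (m - 1) * s) `^ ((m - 2) / (m - 1))) / (m - 2) - s)) => //.
  near=> t; rewrite /fconj max_r// ltW//; apply: base_gt0 => //.
  by near: t; exact: lt_nbhsl.
apply: derive_eq.
  apply: derive_sub.
  apply: (derive_mul _ (derive_cst _ s)).
  apply: (derive_sub (derive_cst 1 s)).
  apply: (@derive_comp _ (fun y => y `^ ((m - 2) / (m - 1))) (fun t => 1 - (m - 1) * t)).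
  exact: is_derive1_powR.
rewrite /inv_slope /GRing.scale/=.
have -> : (m - 2) / (m - 1) - 1 = - (m - 1)^-1 by field; lra.
by field; apply/andP; split; lra.
Unshelve. all: by end_near. Qed.

Lemma inv_slope_le m s : 2 < m -> 0 <= s <= (2 * (m - 1))^-1 ->
  0 <= inv_slope m s <= 2 * (m - 1) * s.
Proof.
move=> m2 /andP[s0 s1].
have b0 : 2^-1 <= 1 - (m - 1) * s.
  have : 2 * (m - 1) * s <= 1.
    rewrite -[leRHS](@divff _ (2 * (m - 1))); last by rewrite mulf_neq0//; lra.
    by rewrite ler_pM2l//; lra.
  lra.
have bL : 0 < 1 - (m - 1) * s <= 1 by apply/andP; split; [lra|nra].
set Y := 1 - (m - 1) * s in b0 bL *.
set z := Y `^ (m - 1)^-1.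
have zY : Y <= z by rewrite /z; apply: ger1_powR => //; rewrite invf_le1; lra.
have z1 : z <= 1.
  rewrite /z -[leRHS](powRr0 Y); apply: ger_powR => //.
  by rewrite invr_ge0; lra.
rewrite /inv_slope -/Y powRN -/z.
have z0 : 0 < z by lra.
apply/andP; split; first by rewrite subr_ge0 invf_ge1.
rewrite lerBlDr -(ler_pM2r z0) mulVf ?gt_eqF//.
have sE : (m - 1) * s = 1 - Y by rewrite /Y; ring.
rewrite -mulrA sE; nra.
Qed.

(** The mean value theorem and the linear bound on the derivative of the
    conjugate; the estimate keeps the transit time of the shooting problem
    infinite as the amplitude tends to zero. *)
Lemma conj_le_sqr m s : 2 < m -> 0 <= s <= (2 * (m - 1))^-1 ->
  fconj m s <= 2 * (m - 1) * s ^+ 2.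
Proof.
move=> m2 /andP[s0 s1].
have sL c : c <= s -> c < (m - 1)^-1.
  move=> cs; apply: (le_lt_trans cs); apply: (le_lt_trans s1).
  by rewrite ltf_pV2 ?posrE; lra.
have [||c] := @MVT_segment _ (fconj m) (inv_slope m) 0 s s0.
- by move=> x; rewrite in_itv/= => /andP[_ xs]; apply: is_derive_conj => //; apply/sL/ltW.
- apply: within_continuous => x; rewrite /= in_itv/= => /andP[_ xs].
  by apply: is_derive_continuous; apply: is_derive_conj => //; apply: sL.
rewrite in_itv/= conj0 !subr0 => /andP[c0 cs] ->.
rewrite expr2 mulrA ler_wpM2r//.
have /andP[_ /le_trans] : 0 <= inv_slope m c <= 2 * (m - 1) * c.
  by apply: inv_slope_le => //; rewrite c0 (le_trans cs s1).
by apply; rewrite ler_wpM2l//; lra.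
Qed.

Lemma continuous_pos_powR (b : R) : 0 < b ->
  continuous (fun y : R => (Num.max 0 y) `^ b).
Proof.
move=> b0 y; have [y0|y0|->] := ltgtP y 0.
- apply: (@cvg_trans _ (cst (0 : R) @ nbhs y)).
    apply: near_eq_cvg; near=> t; rewrite max_l ?powR0 ?gt_eqF//.
    by apply: ltW; near: t; exact: lt_nbhsl.
  by rewrite max_l ?ltW// powR0 ?gt_eqF//; exact: cvg_cst.
- apply: (@cvg_trans _ ((fun y => y `^ b) @ nbhs y)).
    apply: near_eq_cvg; near=> t; rewrite max_r//.
    by apply: ltW; near: t; exact: lt_nbhsr.
  rewrite max_r ?ltW//.
  exact: (@is_derive_continuous _ (fun y => y `^ b) y _ (is_derive1_powR b y0)).
- rewrite /continuous_at maxxx powR0 ?gt_eqF//; apply/cvgrPdist_lt => e e0.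
  have d0 : 0 < e `^ b^-1 by rewrite powR_gt0.
  near=> t; rewrite sub0r normrN ger0_norm ?powR_ge0//.
  have : `|t| < e `^ b^-1 by near: t; exists (e `^ b^-1) => // t; rewrite /ball/= sub0r normrN.
  have t0 : 0 <= Num.max 0 t by rewrite le_max lexx.
  move=> te; rewrite [ltRHS](_ : e = (e `^ b^-1) `^ b); last first.
    by rewrite -powRrM mulVf ?gt_eqF// powRr1// ltW.
  apply: gt0_ltr_powR => //; rewrite ?nnegrE ?ltW//.
  by rewrite gt_max d0 (le_lt_trans (ler_norm t) te).
Unshelve. all: by end_near. Qed.

Lemma continuous_conj m : 2 < m -> continuous (fconj m).
Proof.
move=> m2 s; rewrite /continuous_at /fconj; apply: cvgB; last exact: cvg_id.
apply: cvgM; last exact: cvg_cst.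
apply: cvgB; first exact: cvg_cst.
apply: (@continuous_comp _ _ _ (fun t => 1 - (m - 1) * t)
  (fun y => (Num.max 0 y) `^ ((m - 2) / (m - 1)))).
  by apply: cvgB; [exact: cvg_cst|apply: cvgM => //; exact: cvg_cst].
by apply: continuous_pos_powR; rewrite divr_gt0; lra.
Qed.

Lemma F_ge0 m p : 2 < m -> 0 <= F m p.
Proof.
move=> m2; have := @fenchel m 0 p m2; rewrite mul0r conj0 subr0; apply.
by rewrite lexx invr_ge0; lra.
Qed.

Lemma F_le m p : 2 < m -> F m p <= (m - 1)^-1 * `|p|.
Proof.
move=> m2; rewrite /F Phi_primitive// /primitive mulrC gerBl.
rewrite divr_ge0 ?subr_ge0//; last by rewrite mulr_ge0; lra.
rewrite -[leRHS](powRr0 (1 + `|p|)); apply: ler_powR; last lra.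
by rewrite lerDl.
Qed.

Lemma measurable_F m : 2 < m -> measurable_fun [set: R] (F m).
Proof.
move=> m2; have -> : F m = primitive m \o (@Num.Def.normr _ R).
  by apply/funext => p; rewrite /F Phi_primitive.
apply: measurableT_comp => //.
rewrite /primitive; apply: measurable_funB.
  exact: measurable_funM.
apply: measurable_funM => //.
apply: measurable_funB => //.
apply: (measurableT_comp (measurable_powR _)).
exact: measurable_funD.
Qed.

Lemma inv_slope_ge0 (m s : R) : 2 < m -> 0 <= s < (m - 1)^-1 -> 0 <= inv_slope m s.
Proof.
move=> m2 /andP[s0 sL]; have b0 := base_gt0 m2 sL.
rewrite /inv_slope powRN subr_ge0 invf_ge1 ?powR_gt0//.
rewrite -[leRHS](powRr0 (1 - (m - 1) * s)); apply: ger_powR.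
  by rewrite b0; nra.
by rewrite invr_ge0; lra.
Qed.

Lemma continuous_inv_slope (m s : R) : 2 < m -> s < (m - 1)^-1 ->
  {for s, continuous (inv_slope m)}.
Proof.
move=> m2 sL; have b0 := base_gt0 m2 sL.
rewrite /prop_for /continuous_at /inv_slope; apply: cvgB; last exact: cvg_cst.
apply: (@continuous_comp _ _ _ (fun t : R => 1 - (m - 1) * t) (fun y : R => y `^ (- (m - 1)^-1))).
  by apply: cvgB; [exact: cvg_cst|apply: cvgM; [exact: cvg_cst|exact: cvg_id]].
exact: (is_derive_continuous (is_derive1_powR (- (m - 1)^-1) b0)).
Qed.

End Conjugate.
(** * Shooting: the Euler--Lagrange system on a half interval *)

Section Shooting.
Context {R : realType}.
Local Notation leb := (@lebesgue_measure R).
Variables (L lam C s0 : R) (H G : R -> R).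
Hypotheses (L0 : 0 < L) (lam0 : 0 < lam) (C0 : 0 < C).
Hypotheses (s00 : 0 < s0) (s0L : s0 <= L).
Hypothesis cH : continuous H.
Hypothesis H_ge0 : forall s : R, 0 <= s <= L -> 0 <= H s.
Hypothesis H_sqr : forall s : R, 0 <= s <= s0 -> H s <= C * s ^+ 2.
Hypothesis dH : forall s : R, s < L -> is_derive s 1 H (G s).

(** First integral of the system [sigma' = lam v], [v' = G sigma]: the value
    of [v] as a function of [sigma], when [v = a] where [sigma = 0]. *)
Definition level (a s : R) : R := Num.sqrt (a ^+ 2 + 2 / lam * `|H s|).

Definition time_density (a s : R) : R := (lam * level a s)^-1.

Definition time (a s : R) : R := \int[leb]_(x in `[0, s]) time_density a x.

Implicit Types (a b c s t r x y : R).

Lemma level_sqr a s : level a s ^+ 2 = a ^+ 2 + 2 / lam * `|H s|.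
Proof.
rewrite sqr_sqrtr// addr_ge0 ?sqr_ge0// mulr_ge0// divr_ge0//; exact: ltW.
Qed.

Lemma level_ge a s : 0 < a -> a <= level a s.
Proof.
move=> a0; have {1}-> : a = Num.sqrt (a ^+ 2) by rewrite sqrtr_sqr gtr0_norm.
rewrite /level ler_wsqrtr// lerDl.
by rewrite mulr_ge0// divr_ge0// ltW.
Qed.

Lemma level_gt0 a s : 0 < a -> 0 < level a s.
Proof. by move=> a0; exact: lt_le_trans a0 (level_ge s a0). Qed.

Lemma continuous_level a : continuous (level a).
Proof.
move=> s; rewrite /continuous_at /level.
apply: (@continuous_comp _ _ _ (fun s => a ^+ 2 + 2 / lam * `|H s|) Num.sqrt); last first.
  exact: sqrt_continuous.
apply: cvgD; first exact: cvg_cst.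
apply: cvgM; first exact: cvg_cst.
by apply: cvg_norm; exact: cH.
Qed.

Lemma continuous_time_density a : 0 < a -> continuous (time_density a).
Proof.
move=> a0 s; rewrite /continuous_at /time_density; apply: cvgV.
  by rewrite mulf_neq0// gt_eqF// level_gt0.
by apply: cvgM; [exact: cvg_cst|exact: continuous_level].
Qed.

Lemma time_density_gt0 a s : 0 < a -> 0 < time_density a s.
Proof. by move=> a0; rewrite invr_gt0 mulr_gt0// level_gt0. Qed.

Lemma continuous_integrable (f : R -> R) x y : continuous f ->
  leb.-integrable `[x, y] (EFin \o f).
Proof.
move=> cf; apply: continuous_compact_integrable; first exact: segment_compact.
by apply: within_continuous => z _; exact: cf.
Qed.

(** The bound is uniform in [s], so the transit time is Lipschitz in the
    amplitude away from [0]. *)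
Lemma time_density_lipschitz a b c s : 0 < c -> c <= a -> c <= b ->
  `|time_density a s - time_density b s| <= `|a - b| / (lam * c ^+ 2).
Proof.
move=> c0 ca cb; have a0 : 0 < a by lra. have b0 : 0 < b by lra.
have := level_sqr a s; have := level_sqr b s.
have := level_ge s a0; have := level_ge s b0; rewrite /time_density.
set p := level a s; set q := level b s => bq ap q2 p2.
have p0 : 0 < p by lra. have q0 : 0 < q by lra.
have -> : (lam * p)^-1 - (lam * q)^-1 = (b - a) * ((a + b) / (lam * p * q * (p + q))).
  have /eqP : (q - p) * (q + p) = (b - a) * (a + b) by nra.
  rewrite -subr_eq0 => /eqP e; apply/eqP; rewrite -subr_eq0.
  have -> : (lam * p)^-1 - (lam * q)^-1 - (b - a) * ((a + b) / (lam * p * q * (p + q)))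
    = ((q - p) * (q + p) - (b - a) * (a + b)) / (lam * p * q * (p + q)).
    by field; rewrite !gt_eqF//; lra.
  by rewrite e mul0r.
have m0 : 0 < lam * p * q * (p + q) by rewrite !mulr_gt0//; lra.
rewrite normrM [in leRHS]distrC ler_wpM2l//.
rewrite ger0_norm; last by rewrite divr_ge0//; lra.
rewrite ler_pdivrMr//.
have pq : c ^+ 2 <= p * q by rewrite expr2 ler_pM//; lra.
rewrite ler_pdivlMl; last by rewrite mulr_gt0// exprn_gt0.
have c2 : 0 < c ^+ 2 by rewrite exprn_gt0.
have h : (a + b) * c ^+ 2 <= (p + q) * (p * q) by rewrite ler_pM//; lra.
have -> : lam * c ^+ 2 * (a + b) = lam * ((a + b) * c ^+ 2) by ring.
have -> : lam * p * q * (p + q) = lam * ((p + q) * (p * q)) by ring.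
by rewrite ler_pM2l.
Qed.

Lemma continuous_time a c : 0 < a -> {within `[a, c], continuous (fun x => time x L)}.
Proof.
move=> a0; pose k := L / (lam * a ^+ 2).
have k0 : 0 < k by rewrite divr_gt0// mulr_gt0// exprn_gt0.
have lip x y : a <= x -> a <= y -> `|time x L - time y L| <= `|x - y| * k.
  move=> ax ay; have x0 : 0 < x by lra. have y0 : 0 < y by lra.
  have ix := continuous_integrable 0 L (continuous_time_density x0).
  have iy := continuous_integrable 0 L (continuous_time_density y0).
  have cd : continuous (fun s => time_density x s - time_density y s).
    by move=> s; apply: cvgB; exact: continuous_time_density.
  have cn : continuous (fun s => `|time_density x s - time_density y s|).
    by move=> s; apply: cvg_norm; exact: cd.
  rewrite /time -RintegralB//; apply: (le_trans (le_normr_Rintegral _ _)) => //.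
    exact: continuous_integrable.
  apply: (@le_trans _ _ (\int[leb]_(s in `[0, L]) (`|x - y| / (lam * a ^+ 2)))).
    apply: le_Rintegral => //; [exact: continuous_integrable| |].
      by apply: continuous_integrable => ?; exact: cvg_cst.
    by move=> s _; exact: time_density_lipschitz.
  rewrite Rintegral_cst//= lebesgue_measure_itv/= lte_fin L0/= subr0 /k.
  by rewrite -mulrA [_^-1 * L]mulrC.
apply/subspace_continuousP => x /=; rewrite in_itv/= => /andP[ax xc].
apply/cvgrPdist_lt => e e0; rewrite near_withinE; near=> y.
rewrite /= in_itv/= => /andP[ay yc].
apply: (le_lt_trans (lip x y ax ay)); rewrite -ltr_pdivlMr//.
by near: y; exists (e / k) => //=; rewrite divr_gt0.
Unshelve. all: by end_near. Qed.

(** The first integral gives [a <= level a s], so [sigma] moves with speed at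
    least [lam a = 2 L]. *)
Lemma time_large : time (2 * L / lam) L <= 2^-1.
Proof.
have a0 : 0 < 2 * L / lam by rewrite divr_gt0// mulr_gt0.
apply: (@le_trans _ _ (\int[leb]_(s in `[0, L]) ((2 * L)^-1))).
  apply: le_Rintegral => //.
  - by apply: continuous_integrable; exact: continuous_time_density.
  - by apply: continuous_integrable => ?; exact: cvg_cst.
  - move=> s _; rewrite lef_pV2 ?posrE ?mulr_gt0 ?level_gt0//.
    by have := level_ge s a0; rewrite ler_pdivrMr// [_ * lam]mulrC.
rewrite Rintegral_cst//= lebesgue_measure_itv/= lte_fin L0/= subr0.
by rewrite invfM -mulrA mulVf ?mulr1// gt_eqF.
Qed.

(** Near the rest point the density of the time is at least that of a linear
    equation, whose transit time diverges logarithmically. *)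
Lemma time_small : exists2 a, 0 < a <= 2 * L / lam & 2^-1 <= time a L.
Proof.
pose q := Num.sqrt (2 * C / lam).
have q0 : 0 < q by rewrite sqrtr_gt0 divr_gt0// mulr_gt0.
pose k := lam * q.
have k0 : 0 < k by rewrite mulr_gt0.
(* The second argument of the minimum makes the logarithm at least [k / 2], the
   first keeps the amplitude in the range of the intermediate value theorem. *)
pose A := Num.min (2 * L) (k * s0 / expR (k / 2)).
have A0 : 0 < A.
  by rewrite lt_min mulr_gt0//= divr_gt0 ?expR_gt0// mulr_gt0.
pose a := A / lam.
have a0 : 0 < a by rewrite divr_gt0.
exists a; first by rewrite a0/= ler_pM2r ?invr_gt0// ge_min lexx.
pose g s := (A + k * s)^-1.
have pg s : 0 <= s -> 0 < A + k * s.
  by move=> s_ge0; rewrite ltr_wpDr// mulr_ge0// ltW.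
have cg s : 0 <= s -> {for s, continuous g}.
  move=> s_ge0; rewrite /prop_for /continuous_at /g; apply: cvgV; first by rewrite gt_eqF// pg.
  by apply: cvgD; [exact: cvg_cst|apply: cvgM; [exact: cvg_cst|exact: cvg_id]].
have gl s : 0 <= s <= s0 -> g s <= time_density a s.
  move=> /andP[s_ge0 ss].
  rewrite lef_pV2 ?posrE ?mulr_gt0 ?level_gt0 ?pg//.
  have -> : A + k * s = lam * (a + q * s) by rewrite /a /k; field; rewrite gt_eqF.
  rewrite ler_pM2l//.
  have aq : 0 <= a + q * s by apply: addr_ge0; [exact: ltW|apply: mulr_ge0 => //; exact: ltW].
  rewrite -(@ler_pXn2r _ 2%N) ?nnegrE//; last by rewrite ltW// level_gt0.
  rewrite level_sqr ger0_norm; last by apply: H_ge0; rewrite s_ge0 (le_trans ss).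
  have Hs : H s <= C * s ^+ 2 by apply: H_sqr; rewrite s_ge0.
  have q2 : q ^+ 2 = 2 * C / lam by rewrite sqr_sqrtr// ltW// divr_gt0// mulr_gt0.
  have : 2 / lam * H s <= q ^+ 2 * s ^+ 2.
    rewrite q2 (_ : 2 * C / lam * s ^+ 2 = 2 / lam * (C * s ^+ 2)); last by field; rewrite gt_eqF.
    by rewrite ler_pM2l// divr_gt0.
  have : 0 <= a * (q * s) by apply: mulr_ge0; [exact: ltW|apply: mulr_ge0 => //; exact: ltW].
  by rewrite sqrrD exprMn; lra.
have : 2^-1 <= \int[leb]_(s in `[0, s0]) g s.
  have -> : \int[leb]_(s in `[0, s0]) g s = ln (A + k * s0) / k - ln (A + k * 0) / k.
    apply: (@Rintegral_FTC2 _ g (fun s => ln (A + k * s) / k) 0 s0 (ltW s00)).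
      by move=> s /andP[s_ge0 _]; exact: cg.
    move=> s /andP[s_ge0 _]; have ps := pg s s_ge0.
    apply: derive_eq.
      apply: (derive_mul _ (derive_cst _ s)).
      apply: (@derive_comp _ (@ln R) (fun t => A + k * t)).
      exact: is_derive1_ln.
    by rewrite /g /GRing.scale/=; field; rewrite !gt_eqF.
  have h0 := pg s0 (ltW s00).
  rewrite mulr0 addr0 -mulrBl ler_pdivlMr// -ln_div ?posrE//.
  rewrite -[leLHS]expRK ler_ln ?posrE ?expR_gt0 ?divr_gt0//.
  rewrite ler_pdivlMr// mulrC (_ : 2^-1 * k = k / 2); last by rewrite mulrC.
  have : A * expR (k / 2) <= k * s0.
    by rewrite -ler_pdivlMr ?expR_gt0// ge_min lexx orbT.
  lra.
move=> /le_trans; apply.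
have cgl : {within `[0, s0], continuous g}.
  by apply: within_continuous => s; rewrite /= in_itv/= => /andP[s_ge0 _]; exact: cg.
apply: (@le_trans _ _ (\int[leb]_(s in `[0, s0]) time_density a s)).
  apply: le_Rintegral => //.
  - by apply: continuous_compact_integrable => //; exact: segment_compact.
  - by apply: continuous_integrable; exact: continuous_time_density.
rewrite -subr_ge0 /time (@Rintegral_itvB _ _ (BLeft 0) (BRight L) s0)//.
- by apply: Rintegral_ge0 => s _; rewrite ltW// time_density_gt0.
- by apply: continuous_integrable; exact: continuous_time_density.
- by rewrite bnd_simp ltW.
Qed.

Lemma shooting_level : exists2 a, 0 < a <= 2 * L / lam & time a L = 2^-1.
Proof.
have [a /andP[a0 aL] Ta] := time_small.
have [|c] := @IVT R (fun x => time x L) a (2 * L / lam) 2^-1 aL (continuous_time a0).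
  by rewrite ge_min le_max time_large Ta orbT.
rewrite in_itv/= => /andP[ac cL] Tc; exists c => //.
by rewrite cL (lt_le_trans a0).
Qed.

Lemma time0 a : time a 0 = 0.
Proof. by rewrite /time set_itv1 Rintegral_set1. Qed.

Lemma is_derive_time a s : 0 < a -> 0 < s ->
  is_derive s 1 (time a) (time_density a s).
Proof.
move=> a0 s_gt0.
have su : s < s + 1 by rewrite ltrDl.
have cs : {for s, continuous (time_density a)} by exact: continuous_time_density.
have [dT eT] := continuous_FTC1_closed su
  (continuous_integrable 0 (s + 1) (continuous_time_density a0)) s_gt0
  cs.
by split=> //; rewrite -eT derive1E.
Qed.

Lemma within_continuous_time a : 0 < a -> {within `[0, L], continuous (time a)}.
Proof.
move=> a0; apply: parameterized_integral_continuous; first exact: ltW.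
exact: continuous_integrable (continuous_time_density a0).
Qed.

Lemma time_increasing a x y : 0 < a -> 0 <= x -> x < y -> y <= L ->
  time a x < time a y.
Proof.
move=> a0 x0 xy yL; apply: (@gtr0_derive1_lt_cc _ (time a) 0 L) => //.
- by move=> s; rewrite in_itv/= => /andP[s_gt0 _]; case: (is_derive_time a0 s_gt0).
- move=> s; rewrite in_itv/= => /andP[s_gt0 _].
  by rewrite derive1E (@derive_val _ _ _ _ _ _ _ (is_derive_time a0 s_gt0)) time_density_gt0.
- exact: within_continuous_time.
- by rewrite in_itv/= x0/= ltW// (lt_le_trans xy).
- by rewrite in_itv/= yL (le_trans x0 (ltW xy)).
Qed.

(** [sigma] is the inverse of the time map, for the amplitude whose transit
    time is [1/2]. *)
Lemma shooting : exists (a : R) (sigma : R -> R),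
  [/\ 0 < a <= 2 * L / lam, continuous sigma,
      forall t : R, t <= 0 -> sigma t = 0,
      forall t : R, 2^-1 <= t -> sigma t = L
    & forall t : R, 0 < t < 2^-1 ->
        0 < sigma t < L /\ is_derive t 1 sigma (lam * level a (sigma t))].
Proof.
have [a aL TL] := shooting_level; have a0 : 0 < a by case/andP: aL.
pose inv t s := 0 <= s <= L /\ time a s = t.
pose sigma t := if t <= 0 then 0 else if 2^-1 <= t then L else xget 0 [set s | inv t s].
have sK t : 0 < t < 2^-1 -> inv t (sigma t).
  move=> /andP[t0 t1].
  have := @segment_continuous_le_surjective _ 0 L (time a) (ltW L0).
  rewrite time0 TL => /(_ ltac:(by rewrite invr_ge0) (within_continuous_time a0) t).
  rewrite /= !in_itv/= (ltW t0) (ltW t1) => /(_ isT)[s sL st].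
  rewrite /sigma leNgt t0/= leNgt t1/=.
  by case: xgetP => [z _ //|/(_ s)[]]; split; rewrite // -(in_itv (Interval (BLeft 0) (BRight L))).
have mono x y : 0 <= x <= L -> 0 <= y <= L -> time a x < time a y -> x < y.
  move=> /andP[x0 xL] /andP[y0 yL]; rewrite ltNge => h; rewrite ltNge; apply/negP => yx.
  move: h; rewrite le_eqVlt negb_or => /andP[/eqP h1 /negP h2].
  move: yx; rewrite le_eqVlt => /predU1P[e|yx]; first by apply: h1; rewrite e.
  by apply: h2; exact: time_increasing.
have sI t : 0 < t < 2^-1 -> 0 < sigma t < L.
  move=> t01; have [sL st] := sK t t01; case/andP: t01 => t0 t1.
  by apply/andP; split; apply: mono => //; rewrite ?lexx ?ltW//= ?time0 ?TL st.
have s0E t : t <= 0 -> sigma t = 0 by move=> t0; rewrite /sigma t0.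
have sLE t : 2^-1 <= t -> sigma t = L.
  move=> t1; rewrite /sigma t1 leNgt (lt_le_trans _ t1)//= invr_gt0//.
have Ks s : 0 < s < L -> sigma (time a s) = s.
  move=> /andP[s_gt0 sL].
  have t01 : 0 < time a s < 2^-1.
    by rewrite -(time0 a) -TL !time_increasing//; exact: ltW.
  have [zL zt] := sK _ t01.
  have sL' : 0 <= s <= L by rewrite !ltW.
  have [zs|zs|//] := ltgtP (sigma (time a s)) s.
  - have /andP[z0 _] := zL; have := time_increasing a0 z0 zs (ltW sL).
    by rewrite zt ltxx.
  - have /andP[_ z1] := zL; have := time_increasing a0 (ltW s_gt0) zs z1.
    by rewrite zt ltxx.
have ds t : 0 < t < 2^-1 -> is_derive t 1 sigma (lam * level a (sigma t)).
  move=> t01; have /andP[st0 stL] := sI t t01; have [_ tE] := sK t t01.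
  suff : is_derive (time a (sigma t)) 1 sigma (time_density a (sigma t))^-1.
    by rewrite tE invrK.
  apply: is_derive_inverse.
  - near=> s; apply: Ks; apply/andP; split; near: s; [exact: lt_nbhsr|exact: lt_nbhsl].
  - near=> s; have s_gt0 : 0 < s by near: s; exact: lt_nbhsr.
    exact: is_derive_continuous (is_derive_time a0 s_gt0).
  - exact: is_derive_time.
  - by rewrite gt_eqF// time_density_gt0.
have h0 : (0 : R) < 2^-1 by rewrite invr_gt0.
have range t : 0 <= sigma t <= L.
  have [t0|t0] := leP t 0; first by rewrite s0E// lexx ltW.
  have [t1|t1] := leP 2^-1 t; first by rewrite sLE// lexx ltW.
  by have [] := sK t; rewrite ?t0 ?t1.
have cs : continuous sigma.
  move=> t; have [t0|t0|->] := ltgtP t 0.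
  - apply: (@cvg_trans _ (cst (0 : R) @ nbhs t)); last by rewrite s0E ?ltW//; exact: cvg_cst.
    by apply: near_eq_cvg; near=> r; rewrite s0E// ltW//; near: r; exact: lt_nbhsl.
  - have [t1|t1|->] := ltgtP t 2^-1.
    + by apply: is_derive_continuous; apply: ds; rewrite t0 t1.
    + apply: (@cvg_trans _ (cst L @ nbhs t)); last by rewrite sLE ?ltW//; exact: cvg_cst.
      by apply: near_eq_cvg; near=> r; rewrite sLE// ltW//; near: r; exact: lt_nbhsr.
    + apply/cvgrPdist_lt => e e0; rewrite sLE//.
      pose d := Num.min (L / 2) e.
      have d0 : 0 < d by rewrite lt_min e0 divr_gt0.
      have dL : d < L by rewrite gt_min ltr_pdivrMr// ltr_pMr// ltr1n.
      have de : d <= e by rewrite ge_min lexx orbT.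
      have td : time a (L - d) < 2^-1 by rewrite -TL; apply: time_increasing => //; lra.
      near=> r; have /andP[r0 rL] := range r; rewrite ger0_norm ?subr_ge0//.
      suff : L - d < sigma r by lra.
      have [r1|r1] := leP 2^-1 r; first by rewrite sLE//; lra.
      have r01 : 0 < r < 2^-1.
        by rewrite r1 andbT; near: r; exact: lt_nbhsr.
      have [zL zt] := sK r r01; apply: mono => //; first by rewrite subr_ge0 (ltW dL)/= gerBl ltW.
      by rewrite zt; near: r; exact: lt_nbhsr.
  - apply/cvgrPdist_lt => e e0; rewrite s0E//.
    pose d := Num.min L e.
    have d0 : 0 < d by rewrite lt_min e0 L0.
    have dL : d <= L by rewrite ge_min lexx.
    have de : d <= e by rewrite ge_min lexx orbT.
    have td : 0 < time a d by rewrite -(time0 a); apply: time_increasing.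
    near=> r; have /andP[r0 rL] := range r; rewrite sub0r normrN ger0_norm//.
    suff : sigma r < d by lra.
    have [r1|r1] := leP r 0; first by rewrite s0E.
    have r01 : 0 < r < 2^-1.
      by rewrite r1/=; near: r; exact: lt_nbhsl.
    have [zL zt] := sK r r01; apply: mono => //; first by rewrite (ltW d0) dL.
    by rewrite zt; near: r; exact: lt_nbhsl.
exists a, sigma; split=> // t t01; split; [exact: sI|exact: ds].
Unshelve. all: by end_near. Qed.

Lemma is_derive_level a s : 0 < a -> 0 < s < L ->
  is_derive s 1 (level a) (G s / (lam * level a s)).
Proof.
move=> a0 /andP[s_gt0 sL].
apply: (@near_eq_is_derive _ _ _ (fun s => Num.sqrt (a ^+ 2 + 2 / lam * H s))) => //.
  near=> t; rewrite /level ger0_norm//; apply: H_ge0.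
  by apply/andP; split; apply: ltW; near: t; [exact: lt_nbhsr|exact: lt_nbhsl].
have Hs : 0 <= H s by apply: H_ge0; rewrite !ltW.
have r0 : 0 < a ^+ 2 + 2 / lam * H s.
  by rewrite ltr_wpDr ?exprn_gt0// mulr_ge0// divr_ge0// ltW.
have lE : level a s = Num.sqrt (a ^+ 2 + 2 / lam * H s) by rewrite /level ger0_norm.
apply: derive_eq.
  apply: (@derive_comp _ Num.sqrt (fun t => a ^+ 2 + 2 / lam * H t)).
    exact: is_derive1_sqrt.
  apply: (derive_add (derive_cst _ s)).
  exact: (derive_mul (derive_cst _ s) (dH sL)).
rewrite -lE; field; rewrite !gt_eqF// level_gt0//.
Unshelve. all: by end_near. Qed.

End Shooting.
Section Profile.
Context {R : realType}.

(** With [x = m - 1], the hypothesis on [lam] bounds the two terms by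
    [((x - 1) / (4 x)) ^ 2] and [1 / (4 x)], whose sum
    [((x + 1) / (4 x)) ^ 2] is below [1/4] because [x > 1]. *)
Lemma amplitude_bound (m lam a : R) : 2 < m -> 8 / (m - 2) < lam ->
  0 < a <= 2 * (m - 1)^-1 / lam ->
  a ^+ 2 + 2 / lam * ((m - 1) * (m - 2))^-1 < 4^-1.
Proof.
move=> m2 lam8 /andP[a0 aL].
have m20 : 0 < m - 2 by lra.
have lam0 : 0 < lam by apply: lt_trans lam8; rewrite divr_gt0.
have m10 : 0 < m - 1 by lra.
have y0 : 0 < lam^-1 by rewrite invr_gt0.
have y8 : lam^-1 < (m - 2) / 8.
  by rewrite -[ltRHS]invrK ltf_pV2 ?posrE ?invr_gt0 ?divr_gt0// invf_div.
have h1 : a < (m - 2) / (4 * (m - 1)).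
  apply: (le_lt_trans aL).
  have -> : (m - 2) / (4 * (m - 1)) = 2 * (m - 1)^-1 * ((m - 2) / 8).
    by field; rewrite gt_eqF.
  by rewrite ltr_pM2l// mulr_gt0// invr_gt0.
have h2 : 2 / lam * ((m - 1) * (m - 2))^-1 < (4 * (m - 1))^-1.
  have -> : (4 * (m - 1))^-1 = 2 * ((m - 2) / 8) * ((m - 1) * (m - 2))^-1.
    by field; rewrite !gt_eqF.
  by rewrite ltr_pM2r ?invr_gt0 ?mulr_gt0// ltr_pM2l.
have h3 : a ^+ 2 < ((m - 2) / (4 * (m - 1))) ^+ 2.
  by rewrite ltr_pXn2r// nnegrE; [exact: ltW|rewrite divr_ge0// ltW// mulr_gt0].
have h4 : ((m - 2) / (4 * (m - 1))) ^+ 2 + (4 * (m - 1))^-1 < 4^-1.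
  have -> : ((m - 2) / (4 * (m - 1))) ^+ 2 + (4 * (m - 1))^-1 =
     (m / (4 * (m - 1))) ^+ 2 by field; rewrite gt_eqF.
  have -> : (4^-1 : R) = 2^-1 ^+ 2 by rewrite expr2 -invfM; congr (_^-1); ring.
  have h5 : m / (4 * (m - 1)) < 2^-1 by rewrite ltr_pdivrMr ?mulr_gt0//; lra.
  rewrite ltr_pXn2r// nnegrE ?invr_ge0//.
  by rewrite divr_ge0 ?mulr_ge0//; lra.
lra.
Qed.

(** The left half of the candidate minimizer [V] with its dual field
    [sigma]. *)
Lemma profile (m lam : R) : 2 < m -> 8 / (m - 2) < lam ->
  exists (sigma V : R -> R) (M : R),
  [/\ continuous sigma, continuous V,
      (forall t : R, t <= 0 -> sigma t = 0) /\
      (forall t : R, 2^-1 <= t -> sigma t = (m - 1)^-1),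
      forall t : R, 0 < t < 2^-1 -> 0 < sigma t < (m - 1)^-1
    & [/\ forall t : R, 0 < t < 2^-1 -> is_derive t 1 sigma (lam * V t),
      forall t : R, 0 < t < 2^-1 -> is_derive t 1 V (inv_slope m (sigma t)),
      forall t : R, 0 < V t <= M & M < 2^-1]].
Proof.
move=> m2 lam8.
have lam0 : 0 < lam by apply: lt_trans lam8; rewrite divr_gt0//; lra.
have m10 : 0 < m - 1 by lra.
pose L := (m - 1)^-1.
have L0 : 0 < L by rewrite invr_gt0.
have s00 : 0 < (2 * (m - 1))^-1 by rewrite invr_gt0 mulr_gt0.
have s0L : (2 * (m - 1))^-1 <= L.
  by rewrite lef_pV2 ?posrE ?mulr_gt0//; lra.
have C0 : 0 < 2 * (m - 1) by rewrite mulr_gt0.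
have dH s : s < L -> is_derive s 1 (fconj m) (inv_slope m s).
  by move=> sL; exact: is_derive_conj.
have [a [sigma [aL cs sl sr sm]]] := shooting L0 lam0 C0 s00 s0L
  (continuous_conj m2) (fun s => @conj_ge0 _ m s m2)
  (fun s => @conj_le_sqr _ m s m2).
have a0 : 0 < a by case/andP: aL.
have sL t : 0 <= sigma t <= L.
  have [t0|t0] := leP t 0; first by rewrite sl// lexx ltW.
  have [t1|t1] := leP 2^-1 t; first by rewrite sr// lexx ltW.
  by have [] := sm t; rewrite ?t0// => /andP[/ltW -> /ltW ->].
pose P := level lam (fconj m) a.
pose c := a ^+ 2 + 2 / lam * ((m - 1) * (m - 2))^-1.
have c0 : 0 <= c.
  apply: addr_ge0; first exact: sqr_ge0.
  apply: mulr_ge0; first by rewrite divr_ge0// ltW.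
  by rewrite invr_ge0 mulr_ge0//; lra.
have cP : continuous P by exact: continuous_level (continuous_conj m2) a.
exists sigma, (P \o sigma), (Num.sqrt c); split => //.
- by move=> t; apply: continuous_comp; [exact: cs|exact: cP].
- by move=> t /sm[].
- split.
  + by move=> t /sm[].
  + move=> t t01; have [sL' ds] := sm t t01.
    apply: derive_eq.
      apply: (derive_comp _ ds).
      exact: (is_derive_level lam0 (fun s => @conj_ge0 _ m s m2) dH a0 sL').
    by rewrite /P; field; rewrite !gt_eqF// level_gt0.
  + move=> t; rewrite /= /P level_gt0//= /level ler_wsqrtr// lerD2l.
    rewrite ler_pM2l ?divr_gt0// ger0_norm; first exact: conj_le.
    exact: conj_ge0.
  + have /= h := amplitude_bound m2 lam8 aL.
    have -> : 2^-1 = Num.sqrt (4^-1 : R).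
      have -> : (4^-1 : R) = 2^-1 ^+ 2 by rewrite expr2 -invfM; congr (_^-1); ring.
      by rewrite sqrtr_sqr ger0_norm// invr_ge0.
    by rewrite ltr_sqrt// invr_gt0.
Qed.

End Profile.
(** * Integration against charges *)

Section ChargeIntegral.
Context {d : measure_display} {T : measurableType d} {R : realType}.
Implicit Types (nu n : {charge set T -> \bar R}) (A B : set T) (phi : T -> R).
Local Open Scope ereal_scope.

Definition bounded_on A phi := exists M : R, forall x, A x -> (`|phi x| <= M)%R.

Lemma bounded_on_integrable (m : {measure set T -> \bar R}) A phi :
  measurable A -> m A < +oo -> measurable_fun A phi -> bounded_on A phi ->
  m.-integrable A (EFin \o phi).
Proof.
move=> mA mAoo mphi [M phiM]; apply: measurable_bounded_integrable => //.
exists M; split; first exact: num_real.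
by move=> y My x /= Ax; rewrite (le_trans (phiM x Ax))// ltW.
Qed.

Lemma pos_part_fin nu B : measurable B -> pos_part nu B \is a fin_num.
Proof. by move=> mB; rewrite /pos_part fin_num_measure. Qed.

Lemma neg_part_fin nu B : measurable B -> neg_part nu B \is a fin_num.
Proof. by move=> mB; rewrite /neg_part fin_num_measure. Qed.

Lemma charge_jordan nu B : measurable B -> nu B = pos_part nu B - neg_part nu B.
Proof.
by move=> mB; rewrite [LHS](jordan_decomp (svalP (hahn_sets nu)) mB) /cadd/= cscaleN1.
Qed.

Lemma pos_part_integrable nu A phi : measurable A -> measurable_fun A phi ->
  bounded_on A phi -> (pos_part nu).-integrable A (EFin \o phi).
Proof.
by move=> mA ? ?; apply: bounded_on_integrable => //; rewrite ltey_eq pos_part_fin.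
Qed.

Lemma neg_part_integrable nu A phi : measurable A -> measurable_fun A phi ->
  bounded_on A phi -> (neg_part nu).-integrable A (EFin \o phi).
Proof.
by move=> mA ? ?; apply: bounded_on_integrable => //; rewrite ltey_eq neg_part_fin.
Qed.

Lemma charge_integral_fin nu A phi : measurable A -> measurable_fun A phi ->
  bounded_on A phi -> charge_integral nu A phi \is a fin_num.
Proof.
move=> mA mphi bphi; rewrite fin_numB; apply/andP; split.
  by apply: integrable_fin_num => //; exact: pos_part_integrable.
by apply: integrable_fin_num => //; exact: neg_part_integrable.
Qed.

(** The Jordan parts do not add up, but the positive part of either side plus the
    negative parts of the other give the same finite measure on the subsets of
    [A]. *)
Lemma charge_integralD nu n1 n2 A phi : measurable A -> measurable_fun A phi ->
  bounded_on A phi ->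
  (forall B, measurable B -> B `<=` A -> nu B = n1 B + n2 B) ->
  charge_integral nu A phi = charge_integral n1 A phi + charge_integral n2 A phi.
Proof.
move=> mA mphi bphi nuE.
have me : measurable_fun A (EFin \o phi) by exact/measurable_EFinP.
have ip nu' := @pos_part_integrable nu' A phi mA mphi bphi.
have iq nu' := @neg_part_integrable nu' A phi mA mphi bphi.
have E : \int[measure_add (pos_part nu) (measure_add (neg_part n1) (neg_part n2))]_(x in A) (phi x)%:E =
  \int[measure_add (neg_part nu) (measure_add (pos_part n1) (pos_part n2))]_(x in A) (phi x)%:E.
  apply: eq_measure_integral => B mB BA.
  rewrite [LHS]measure_addE [RHS]measure_addE.
  rewrite [X in _ + X = _]measure_addE [X in _ = _ + X]measure_addE.
  have := nuE B mB BA; rewrite !charge_jordan//.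
  move: (pos_part_fin nu mB) (pos_part_fin n1 mB) (pos_part_fin n2 mB).
  move: (neg_part_fin nu mB) (neg_part_fin n1 mB) (neg_part_fin n2 mB).
  move=> /fineK <- /fineK <- /fineK <- /fineK <- /fineK <- /fineK <-.
  rewrite -!EFinB -!EFinD => -[e]; congr EFin; lra.
have ipp : (measure_add (pos_part n1) (pos_part n2)).-integrable A (EFin \o phi).
  apply: bounded_on_integrable => //.
  rewrite [ltLHS]measure_addE; have := pos_part_fin n1 mA; have := pos_part_fin n2 mA.
  by move=> /fineK <- /fineK <-; rewrite -EFinD ltry.
have iqq : (measure_add (neg_part n1) (neg_part n2)).-integrable A (EFin \o phi).
  apply: bounded_on_integrable => //.
  rewrite [ltLHS]measure_addE; have := neg_part_fin n1 mA; have := neg_part_fin n2 mA.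
  by move=> /fineK <- /fineK <-; rewrite -EFinD ltry.
move: E; rewrite !integral_measure_add// /charge_integral.
have fp nu' := integrable_fin_num mA (ip nu').
have fq nu' := integrable_fin_num mA (iq nu').
move: (fp nu) (fp n1) (fp n2) (fq nu) (fq n1) (fq n2).
move=> /fineK <- /fineK <- /fineK <- /fineK <- /fineK <- /fineK <-.
rewrite -!EFinB -!EFinD => -[e]; congr EFin; lra.
Qed.

(** The negative part of a set is minus the charge of its intersection with the
    negative Hahn set, hence both nonnegative and nonpositive here. *)
Lemma jordan_measure nu (m : {measure set T -> \bar R}) A :
  (forall B, measurable B -> B `<=` A -> nu B = m B) ->
  forall B, measurable B -> B `<=` A -> pos_part nu B = m B /\ neg_part nu B = 0.
Proof.
move=> nuE B mB BA.
have q0 : neg_part nu B = 0.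
  apply/eqP; rewrite eq_le measure_ge0 andbT.
  rewrite -[X in X <= _]/(jordan_neg (svalP (hahn_sets nu)) B) jordan_negE cjordan_negE /crestr0 mem_set// /crestr/= nuE.
  - by rewrite oppe_le0 measure_ge0.
  - by apply: measurableI => //; case: (svalP (hahn_sets nu)) => _ [].
  - by move=> x [/BA].
split=> //; rewrite -nuE// (charge_jordan nu mB) q0 sube0//.
Qed.

Lemma charge_integral_measure nu (m : {measure set T -> \bar R}) A phi :
  measurable A -> (forall B, measurable B -> B `<=` A -> nu B = m B) ->
  charge_integral nu A phi = \int[m]_(x in A) (phi x)%:E.
Proof.
move=> mA nuE; rewrite /charge_integral.
rewrite (@eq_measure_integral _ _ _ _ m); last first.
  by move=> B mB BA; case: (jordan_measure nuE mB BA).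
rewrite [X in _ - X](@eq_measure_integral _ _ _ _ mzero); last first.
  by move=> B mB BA; case: (jordan_measure nuE mB BA).
by rewrite integral_measure_zero sube0.
Qed.

Lemma tot_var_measure nu (m : {measure set T -> \bar R}) A :
  measurable A -> (forall B, measurable B -> B `<=` A -> nu B = m B) ->
  tot_var nu A = m A.
Proof.
move=> mA nuE; have [pE qE] := jordan_measure nuE mA (@subset_refl _ A).
have -> : tot_var nu A = pos_part nu A + neg_part nu A by [].
by rewrite pE qE adde0.
Qed.

Lemma charge_integral_ext nu n1 A phi : measurable A -> measurable_fun A phi ->
  bounded_on A phi -> (forall B, measurable B -> B `<=` A -> nu B = n1 B) ->
  charge_integral nu A phi = charge_integral n1 A phi.
Proof.
move=> mA mphi bphi nuE.
rewrite (@charge_integralD nu n1 (czero : {charge set T -> \bar R}) A)//; last first.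
  by move=> B mB BA; rewrite nuE// /czero/= adde0.
by rewrite [X in _ + X](@charge_integral_measure _ mzero)// integral_measure_zero adde0.
Qed.

Lemma charge_integral_le_tot_var nu A phi (M : R) : measurable A ->
  measurable_fun A phi -> (0 <= M)%R -> (forall x, A x -> (0 <= phi x <= M)%R) ->
  charge_integral nu A phi <= M%:E * tot_var nu A.
Proof.
move=> mA mphi M0 phiM; rewrite /charge_integral.
have q0 : 0 <= \int[neg_part nu]_(x in A) (phi x)%:E.
  by apply: integral_ge0 => x /phiM/andP[]; rewrite lee_fin.
have -> : tot_var nu A = pos_part nu A + neg_part nu A by [].
apply: (@le_trans _ _ (M%:E * pos_part nu A)).
  apply: (@le_trans _ _ (\int[pos_part nu]_(x in A) (phi x)%:E)).
    by rewrite leeBlDr ?leeDl//; apply: integrable_fin_num => //;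
       apply: neg_part_integrable => //; exists M => x /phiM/andP[p0 pM]; rewrite ger0_norm.
  rewrite -integral_cst//; apply: ge0_le_integral => //.
  - by move=> x /phiM/andP[]; rewrite lee_fin.
  - exact/measurable_EFinP.
  - by move=> x /phiM/andP[_]; rewrite lee_fin.
by rewrite lee_wpmul2l ?lee_fin// leeDl// measure_ge0.
Qed.

(** The Radon--Nikodym derivatives of the two Jordan parts recombine to the
    density. *)
Lemma charge_integral_density (mu : {sigma_finite_measure set T -> \bar R}) nu
    (g : T -> R) A phi : measurable A -> measurable_fun A phi -> bounded_on A phi ->
  mu.-integrable A (EFin \o g) ->
  (forall B, measurable B -> B `<=` A -> nu B = \int[mu]_(x in B) (g x)%:E) ->
  charge_integral nu A phi = \int[mu]_(x in A) (phi x * g x)%:E.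
Proof.
move=> mA mphi bphi ig nuE.
have ig0 : mu.-integrable setT ((EFin \o g) \_ A) by apply/(integrable_mkcond _ mA).
pose gam : {charge set T -> \bar R} := induced_charge ig0.
have gamE B : measurable B -> B `<=` A -> gam B = \int[mu]_(x in B) (g x)%:E.
  move=> mB BA; apply: eq_integral => x; rewrite inE => /BA Ax.
  by rewrite patchE mem_set.
rewrite (@charge_integral_ext nu gam)//; last by move=> B mB BA; rewrite nuE// gamE.
have gamdom : gam `<< mu.
  apply/null_content_dominatesP => B mB muB.
  have -> : gam B = \int[mu]_(x in B) ((EFin \o g) \_ A) x by [].
  by apply: null_set_integral => //; apply: (measurable_int mu); exact: (integrableS measurableT).
pose p := jordan_pos (svalP (hahn_sets gam)).
pose q := jordan_neg (svalP (hahn_sets gam)).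
have pdom : p `<< mu by exact: jordan_pos_dominates.
have qdom : q `<< mu by exact: jordan_neg_dominates.
have ip := @pos_part_integrable gam A phi mA mphi bphi.
have iq := @neg_part_integrable gam A phi mA mphi bphi.
rewrite /charge_integral.
rewrite -(Radon_Nikodym_change_of_variables pdom mA ip).
rewrite -(Radon_Nikodym_change_of_variables qdom mA iq).
set rp := Radon_Nikodym _ _; set rq := Radon_Nikodym _ _.
have irp : mu.-integrable A rp by apply: (integrableS measurableT) => //; exact: Radon_Nikodym_integrable.
have irq : mu.-integrable A rq by apply: (integrableS measurableT) => //; exact: Radon_Nikodym_integrable.
have [M phiM] := bphi.
have me : measurable_fun A (EFin \o phi) by exact/measurable_EFinP.
have iM (h : T -> \bar R) : mu.-integrable A h -> mu.-integrable A (fun x => (phi x)%:E * h x).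
  move=> ih; apply: (@le_integrable _ _ _ _ _ mA _ (fun x => M%:E * h x)).
  - by apply: emeasurable_funM => //; exact: measurable_int ih.
  - move=> x Ax; rewrite !abseM lee_wpmul2r//= lee_fin.
    by rewrite (le_trans (phiM x Ax))// ler_norm.
  - exact: integrableZl.
rewrite -integralB//; [|exact: iM|exact: iM].
apply: ae_eq_integral => //.
- by apply: emeasurable_funB; apply: measurable_int; exact: iM.
- by apply: (measurable_int mu); apply: (iM (EFin \o g)).
have : ae_eq mu A (rp \- rq) (EFin \o g).
  apply: integral_ae_eq => //.
  - exact: integrableB.
  - exact: measurable_int ig.
  - move=> E EA mE; rewrite integralB//; [|exact: (integrableS mA)..].
    rewrite /rp /rq -!Radon_Nikodym_integral//.
    by rewrite -gamE// [RHS]charge_jordan.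
apply: filterS => x + Ax => /(_ Ax) /= e.
rewrite EFinM -e muleBr// fin_num_adde_defr//.
exact: Radon_Nikodym_fin_num.
Qed.

Lemma bounded_convergence (m : {measure set T -> \bar R}) A (phi_ : nat -> T -> R) phi
    (M : R) : measurable A -> m A < +oo ->
  (forall k, measurable_fun A (phi_ k)) -> measurable_fun A phi ->
  (forall x, A x -> phi_ k x @[k --> \oo] --> phi x) ->
  (forall k x, A x -> (`|phi_ k x| <= M)%R) ->
  \int[m]_(x in A) (phi_ k x)%:E @[k --> \oo] --> \int[m]_(x in A) (phi x)%:E.
Proof.
move=> mA mAoo mphi_ mphi cvgphi phiM.
have mb k : measurable_fun A (EFin \o phi_ k) by exact/measurable_EFinP.
have ml : measurable_fun A (EFin \o phi) by exact/measurable_EFinP.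
have cb : {ae m, forall x, A x -> (EFin \o phi_ k) x @[k --> \oo] --> (EFin \o phi) x}.
  by apply: aeW => x Ax; apply: cvg_EFin; [exact: nearW|exact: cvgphi].
have i1 : m.-integrable A (cst M%:E).
  apply: (@bounded_on_integrable m A (cst M)) => //.
  by exists `|M|%R => x _.
have le1 : {ae m, forall x k, A x -> `|(EFin \o phi_ k) x| <= cst M%:E x}.
  by apply: aeW => x k Ax; rewrite /= lee_fin phiM.
by have [_ _] := @dominated_convergence _ T R m A mA _ _ (cst M%:E) mb ml cb i1 le1.
Qed.

Lemma cvg_charge_integral nu A (phi_ : nat -> T -> R) phi (M : R) : measurable A ->
  (forall k, measurable_fun A (phi_ k)) -> measurable_fun A phi ->
  (forall x, A x -> phi_ k x @[k --> \oo] --> phi x) ->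
  (forall k x, A x -> (`|phi_ k x| <= M)%R) -> bounded_on A phi ->
  charge_integral nu A (phi_ k) @[k --> \oo] --> charge_integral nu A phi.
Proof.
move=> mA mphi_ mphi cvgphi phiM bphi; apply: cvgeB.
- apply: fin_num_adde_defr; apply: integrable_fin_num => //.
  exact: pos_part_integrable.
- by apply: (@bounded_convergence _ _ _ _ M) => //; rewrite ltey_eq pos_part_fin.
- by apply: (@bounded_convergence _ _ _ _ M) => //; rewrite ltey_eq neg_part_fin.
Qed.

End ChargeIntegral.
(** * Existence of Lebesgue decompositions *)

Section FiniteSum.
Context {d : measure_display} {T : measurableType d} {R : realType}.
Variables m1 m2 : {finite_measure set T -> \bar R}.

Let measure_add_fin : fin_num_fun (measure_add m1 m2).
Proof.
move=> A mA; rewrite [X in X \is a fin_num]measure_addE fin_numD.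
by apply/andP; split; exact: fin_num_measure.
Qed.

HB.instance Definition _ := Measure.on (measure_add m1 m2).

HB.instance Definition _ := Measure_isFinite.Build _ _ _ (measure_add m1 m2) measure_add_fin.

End FiniteSum.

Section LebesgueDecomposition.
Context {d : measure_display} {T : measurableType d} {R : realType}.
Local Open Scope ereal_scope.

Lemma positive_integral0 (m : {measure set T -> \bar R}) A (h : T -> \bar R) :
  measurable A -> measurable_fun A h -> (forall x, A x -> 0 < h x) ->
  \int[m]_(x in A) h x = 0 -> m A = 0.
Proof.
move=> mA mh h0 ih.
have /(ae_eq_integral_abs m mA mh)[N [mN N0 AN]] : \int[m]_(x in A) `|h x| = 0.
  by rewrite -ih; apply: eq_integral => x; rewrite inE => /h0/ltW/gee0_abs.
apply/eqP; rewrite eq_le measure_ge0 andbT -N0 le_measure ?inE//.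
move=> x Ax; apply: AN => /= /(_ Ax) e.
by have := h0 x Ax; rewrite e ltxx.
Qed.

(** The null set carrying the singular part is where the density of [mu] with
    respect to [mu + |nu|] vanishes. *)
Lemma singular_carrier (mu : {measure set T -> \bar R}) (nu : {charge set T -> \bar R}) A :
  measurable A -> mu A < +oo ->
  exists N : set T, [/\ measurable N, N `<=` A, mu N = 0 &
    forall B, measurable B -> B `<=` A `\` N -> mu B = 0 -> nu B = 0].
Proof.
move=> mA muA.
pose muI : {finite_measure set T -> \bar R} := mfrestr mA muA.
pose p : {finite_measure set T -> \bar R} := jordan_pos (svalP (hahn_sets nu)).
pose q : {finite_measure set T -> \bar R} := jordan_neg (svalP (hahn_sets nu)).
pose pq : {finite_measure set T -> \bar R} := measure_add p q.
pose rho : {finite_measure set T -> \bar R} := measure_add muI pq.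
have rhoE B : rho B = mu (B `&` A) + (p B + q B).
  by rewrite [LHS]measure_addE; congr (_ + _); rewrite [LHS]measure_addE.
pose nmu : {charge set T -> \bar R} := charge_of_finite_measure muI.
have dom : nmu `<< rho.
  apply/null_content_dominatesP => B mB rho0.
  move: (rhoE B); rewrite (rho0 : rho B = 0) => /esym/eqP.
  rewrite padde_eq0 ?adde_ge0 ?measure_ge0// => /andP[/eqP muB _].
  exact: muB.
pose h := Radon_Nikodym nmu rho.
have ih : rho.-integrable setT h by exact: Radon_Nikodym_integrable.
have mh B : measurable B -> measurable_fun B h.
  by move=> mB; apply: measurable_funTS; exact: measurable_int ih.
have hE B : measurable B -> B `<=` A -> mu B = \int[rho]_(x in B) h x.
  move=> mB BA; rewrite -Radon_Nikodym_integral//.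
  by rewrite [RHS]/(mu (B `&` A)) (setIidl BA).
pose N := A `&` [set x | h x <= 0].
have mN : measurable N by apply: emeasurable_fun_infty_c => //; exact: mh.
have NA : N `<=` A by exact: subIsetl.
exists N; split=> //.
  apply/eqP; rewrite eq_le measure_ge0 andbT hE//.
  rewrite -[leRHS](integral0 rho N); apply: le_integral => //.
  - exact: (integrableS measurableT).
  - exact: integrable0.
  - by move=> x; rewrite inE => -[].
move=> B mB BAN muB.
have BA : B `<=` A by move=> x /BAN[].
have rhoB : rho B = 0.
  apply: (positive_integral0 mB (mh B mB)); last by rewrite -hE.
  move=> x /BAN[Ax]; rewrite ltNge => Nx; apply/negP => hx; apply: Nx.
  by split.
move/eqP: rhoB; rewrite rhoE padde_eq0 ?adde_ge0 ?measure_ge0// => /andP[_].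
rewrite padde_eq0 ?measure_ge0// => /andP[/eqP p0 /eqP q0].
by rewrite charge_jordan// [pos_part _ _]p0 [neg_part _ _]q0 sube0.
Qed.

Lemma charge_set0_on (nu : {charge set T -> \bar R}) A : measurable A ->
  (forall B, measurable B -> B `<=` A -> nu B = 0) -> tot_var nu A = 0.
Proof. by move=> mA nu0; rewrite (@tot_var_measure _ _ _ nu mzero). Qed.

End LebesgueDecomposition.

Section Cross.
Context {d : measure_display} {T : measurableType d} {R : realType}.
Implicit Types (nu : {charge set T -> \bar R}) (A B : set T) (phi : T -> R).
Local Open Scope ereal_scope.

(** Moving the negative parts to the other side turns an equality of charges
    into an equality of finite measures. *)
Definition cross nu nu' : {finite_measure set T -> \bar R} :=
  measure_add (jordan_pos (svalP (hahn_sets nu))) (jordan_neg (svalP (hahn_sets nu'))).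

Lemma crossE nu nu' B : cross nu nu' B = pos_part nu B + neg_part nu' B.
Proof. exact: measure_addE. Qed.

Lemma integral_cross nu nu' A phi : measurable A -> measurable_fun A phi ->
  bounded_on A phi -> charge_integral nu A phi = charge_integral nu' A phi ->
  \int[cross nu nu']_(x in A) (phi x)%:E = \int[cross nu' nu]_(x in A) (phi x)%:E.
Proof.
move=> mA mphi bphi.
have ip n := @pos_part_integrable _ _ _ n A _ mA mphi bphi.
have iq n := @neg_part_integrable _ _ _ n A _ mA mphi bphi.
have E n n' : \int[cross n n']_(x in A) (phi x)%:E =
    \int[pos_part n]_(x in A) (phi x)%:E + \int[neg_part n']_(x in A) (phi x)%:E.
  exact: (integral_measure_add mA (ip n) (iq n')).
rewrite !E /charge_integral.
have fp n := integrable_fin_num mA (ip n).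
have fq n := integrable_fin_num mA (iq n).
move: (fp nu) (fp nu') (fq nu) (fq nu').
move=> /fineK <- /fineK <- /fineK <- /fineK <-.
by rewrite -!EFinB -!EFinD => -[e]; congr EFin; lra.
Qed.

Lemma charge_cross nu nu' B : measurable B ->
  cross nu nu' B = cross nu' nu B -> nu B = nu' B.
Proof.
move=> mB; rewrite !crossE (charge_jordan nu mB) (charge_jordan nu' mB).
move: (pos_part_fin nu mB) (pos_part_fin nu' mB) (neg_part_fin nu mB) (neg_part_fin nu' mB).
move=> /fineK <- /fineK <- /fineK <- /fineK <-.
by rewrite -!EFinB -!EFinD => -[e]; congr EFin; lra.
Qed.

End Cross.

Section LebesgueDecompositionReal.
Context {R : realType}.
Local Notation leb := (@lebesgue_measure R).
Local Notation I01 := (`]0, 1[%classic : set R).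
Local Notation chargeR := (charge (measurableTypeR R) R).
Local Open Scope ereal_scope.

Lemma lebesgue_I01 : leb I01 = 1.
Proof. by rewrite lebesgue_measure_itv/= lte_fin ltr01 sube0. Qed.

Lemma measurable_I01 : measurable (I01 : set (measurableTypeR R)).
Proof. exact: measurable_itv. Qed.

Lemma lebesgue_decomposition_exists (nu : chargeR) :
  exists (g : R -> R) (nus : chargeR), lebesgue_decomposition nu g nus.
Proof.
have mI := measurable_I01.
have [|N [mN NI N0 nuN]] := @singular_carrier _ _ _ leb nu I01 mI.
  by rewrite [ltLHS]lebesgue_I01 ltry.
have mIN : measurable (I01 `\` N) by exact: measurableD.
pose nua : chargeR := crestr nu mIN.
pose nus : chargeR := crestr nu mN.
have dom : nua `<< leb.
  apply/null_content_dominatesP => B mB B0.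
  apply: nuN; [exact: measurableI|exact: subIsetr|].
  apply/eqP; rewrite eq_le measure_ge0 andbT -B0 le_measure ?inE//.
  exact: measurableI.
pose h := Radon_Nikodym nua leb.
have ih : leb.-integrable setT h by exact: Radon_Nikodym_integrable.
have hE x : (fine (h x))%:E = h x by rewrite fineK//; exact: Radon_Nikodym_fin_num.
exists (fine \o h), nus; split.
- have -> : EFin \o (fine \o h) = h by apply/funext => x /=; exact: hE.
  exact: (integrableS measurableT).
- exists N; split => //; apply: charge_set0_on => // B mB BIN.
  rewrite /nus/= /crestr (_ : B `&` N = set0) ?charge0//.
  by rewrite -subset0 => x [/BIN[]].
- move=> B mB BI; under eq_integral do rewrite /= hE.
  rewrite -Radon_Nikodym_integral// /nua /nus/= /crestr.
  rewrite -[LHS](_ : nu ((B `&` (I01 `\` N)) `|` (B `&` N)) = _).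
    rewrite chargeU//; [exact: measurableI|exact: measurableI|].
    by rewrite -subset0 => x [[_ []]] ? ? [].
  congr (nu _); apply/seteqP; split => x; first by move=> [[]|[]].
  by move=> Bx; have [Nx|Nx] := pselect (N x); [right|left; split => //; split => //; exact: BI].
Qed.

End LebesgueDecompositionReal.
(** * Test functions *)

Section SmoothStep.
Context {R : realType}.
Implicit Types x y : R.

Definition sqpos y : R := Num.max 0 y ^+ 2.

Lemma continuous_maxl : continuous (fun y : R => Num.max 0 y).
Proof.
move=> y; apply: continuous_max; [exact: cvg_cst|exact: cvg_id].
Qed.

Lemma is_derive_sqpos y : is_derive y 1 sqpos (2 * Num.max 0 y).
Proof.
have [y0|y0|->] := ltgtP y 0.
- apply: (@near_eq_is_derive _ _ _ (cst 0)) => //.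
    near=> t; rewrite /sqpos max_l ?expr0n//.
    by apply: ltW; near: t; exact: lt_nbhsl.
  by rewrite mulr0; exact: is_derive_cst.
- apply: (@near_eq_is_derive _ _ _ (fun t : R => t * t)).
    near=> t; rewrite /sqpos max_r ?expr2//.
    by apply: ltW; near: t; exact: lt_nbhsr.
  apply: (derive_eq (derive_mul (derive_id y) (derive_id y))); ring.
- rewrite mulr0.
  suff h : (fun h : R => h^-1 *: (sqpos (h *: 1 + 0) - sqpos 0)) @ 0^' --> (0 : R).
    by split; [apply/cvg_ex; exists 0|apply: cvg_lim].
  apply/cvgrPdist_le => e e0; near=> t.
  rewrite sub0r normrN /sqpos addr0 maxxx expr0n/= subr0 /GRing.scale/= mulr1.
  have te : `|t| < e by near: t; exact: dnbhs0_lt.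
  have tn0 : t != 0 by near: t; exact: nbhs_dnbhs_neq.
  rewrite normrM normfV ler_pdivrMl ?normr_gt0// ger0_norm ?sqr_ge0//.
  have [t0|t0] := leP 0 t.
    by rewrite ger0_norm// expr2 ler_wpM2l// (le_trans (ler_norm t))// ltW.
  by rewrite expr0n/= mulr_ge0// ltW.
Unshelve. all: by end_near. Qed.

(** A step of class C^1 whose derivative is a tent. *)
Definition step y : R := 2 * (sqpos y - 2 * sqpos (y - 2^-1) + sqpos (y - 1)).

Definition dstep y : R :=
  4 * (Num.max 0 y - 2 * Num.max 0 (y - 2^-1) + Num.max 0 (y - 1)).

Lemma is_derive_sqpos_shift (a y : R) :
  is_derive y 1 (fun t => sqpos (t - a)) (2 * Num.max 0 (y - a)).
Proof.
apply: (derive_eq (@derive_comp _ sqpos (fun t => t - a) y _ _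
  (is_derive_sqpos (y - a)) (derive_sub (derive_id y) (derive_cst a y)))).
by rewrite subr0 mulr1.
Qed.

Lemma continuous_max_shift (a : R) : continuous (fun y : R => Num.max 0 (y - a)).
Proof.
move=> y; apply: (@continuous_comp _ _ _ (fun t : R => t - a) (fun t : R => Num.max 0 t)).
  by apply: cvgB; [exact: cvg_id|exact: cvg_cst].
exact: continuous_maxl.
Qed.

Lemma is_derive_step y : is_derive y 1 step (dstep y).
Proof.
apply: (derive_eq (derive_mul (derive_cst 2 y) (derive_add (derive_sub
  (is_derive_sqpos y) (derive_mul (derive_cst 2 y) (is_derive_sqpos_shift 2^-1 y)))
  (is_derive_sqpos_shift 1 y)))).
rewrite /dstep; ring.
Qed.

Lemma continuous_dstep : continuous dstep.
Proof.
move=> y; rewrite /continuous_at /dstep.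
apply: cvgM; first exact: cvg_cst.
apply: cvgD; last exact: continuous_max_shift.
apply: cvgB; first exact: continuous_maxl.
by apply: cvgM; [exact: cvg_cst|exact: continuous_max_shift].
Qed.

Lemma step_le0 y : y <= 0 -> step y = 0.
Proof.
move=> y0; rewrite /step /sqpos !max_l ?expr0n/=; [ring|lra..].
Qed.

Lemma step_ge1 y : 1 <= y -> step y = 1.
Proof.
move=> y1; by rewrite /step /sqpos !max_r; lra.
Qed.

Lemma step_itv y : 0 <= step y <= 1.
Proof.
have [y0|y0] := leP y 0; first by rewrite step_le0// lexx ler01.
have [y1|y1] := leP 1 y; first by rewrite step_ge1// lexx ler01.
have [yh|yh] := leP y 2^-1.
  rewrite /step /sqpos (max_r (ltW y0)) !max_l; [|lra..].
  by rewrite expr0n/=; apply/andP; split; nra.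
rewrite /step /sqpos (max_r (ltW y0)) max_r; last lra.
rewrite max_l; last lra.
by rewrite expr0n/=; apply/andP; split; nra.
Qed.

Lemma test_functionI (phi dphi : R -> R) (a b : R) :
  (forall x, is_derive x 1 phi (dphi x)) -> continuous dphi ->
  0 < a -> b < 1 -> (forall x, x < a \/ b < x -> phi x = 0) -> test_function phi.
Proof.
move=> dph cd a0 b1 ph0.
have e : derive1 phi = dphi by apply/funext => x; rewrite derive1E derive_val.
split; [by move=> x; case: (dph x)|by rewrite e|].
exists a, b; split=> // x; rewrite in_itv/= negb_and -!ltNge => /orP; exact: ph0.
Qed.

Definition bump (s t k x : R) : R := step (k * (x - s) - 1) * step (k * (t - x) - 1).

Lemma test_function_bump (s t k : R) : 0 <= s -> t <= 1 -> 0 < k ->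
  test_function (bump s t k).
Proof.
move=> s0 t1 k0.
pose l x := k * (x - s) - 1. pose r x := k * (t - x) - 1.
have cl : continuous l.
  move=> x; apply: cvgB; last exact: cvg_cst.
  apply: cvgM; first exact: cvg_cst.
  by apply: cvgB; [exact: cvg_id|exact: cvg_cst].
have cr : continuous r.
  move=> x; apply: cvgB; last exact: cvg_cst.
  apply: cvgM; first exact: cvg_cst.
  by apply: cvgB; [exact: cvg_cst|exact: cvg_id].
have dl x : is_derive x 1 (fun x => step (l x)) (dstep (l x) * k).
  apply: (derive_eq (@derive_comp _ step l x _ _ (is_derive_step (l x))
    (derive_sub (derive_mul (derive_cst k x) (derive_sub (derive_id x) (derive_cst s x)))
      (derive_cst 1 x)))).
  ring.
have dr x : is_derive x 1 (fun x => step (r x)) (dstep (r x) * - k).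
  apply: (derive_eq (@derive_comp _ step r x _ _ (is_derive_step (r x))
    (derive_sub (derive_mul (derive_cst k x) (derive_sub (derive_cst t x) (derive_id x)))
      (derive_cst 1 x)))).
  ring.
have comp (f g : R -> R) : continuous f -> continuous g -> continuous (fun x => g (f x)).
  by move=> cf cg x; exact: (@continuous_comp _ _ _ f g x (cf x) (cg (f x))).
have cstep : continuous step by move=> y; exact: is_derive_continuous (is_derive_step y).
apply: (@test_functionI _ (fun x => (dstep (l x) * k) * step (r x)
   + step (l x) * (dstep (r x) * - k)) (s + k^-1) (t - k^-1)).
- by move=> x; exact: (derive_mul (dl x) (dr x)).
- move=> x; apply: cvgD.
  + apply: cvgM; last exact: (comp r step).
    by apply: cvgM; [exact: (comp l dstep _ continuous_dstep)|exact: cvg_cst].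
  + apply: cvgM; first exact: (comp l step).
    by apply: cvgM; [exact: (comp r dstep _ continuous_dstep)|exact: cvg_cst].
- by rewrite ltr_wpDl// invr_gt0.
- by rewrite ltrBlDr (le_lt_trans t1)// ltrDl invr_gt0.
- move=> x [xs|xt]; rewrite /bump.
  + rewrite step_le0 ?mul0r// subr_le0 -ler_pdivlMl// mulr1 lerBlDl ltW//.
  + rewrite [X in _ * X]step_le0 ?mulr0// subr_le0 -ler_pdivlMl// mulr1.
    by rewrite lerBlDr -lerBlDl ltW.
Qed.

Lemma bump_itv (s t k x : R) : 0 <= bump s t k x <= 1.
Proof.
have /andP[a0 a1] := step_itv (k * (x - s) - 1).
have /andP[b0 b1] := step_itv (k * (t - x) - 1).
by rewrite /bump mulr_ge0//= mulr_ile1.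
Qed.

Lemma cvg_bump (s t x : R) :
  bump s t n.+1%:R x @[n --> \oo] --> (\1_(`]s, t[%classic : set R) x : R).
Proof.
rewrite indicE; case: (boolP (x \in _)) => [|].
  rewrite inE/= in_itv/= => /andP[sx xt].
  apply: cvg_near_cst.
  have inf (e : R) : 0 < e -> \forall n \near \oo, 1 <= n.+1%:R * e - 1.
    move=> e0; near=> n; rewrite lerBrDr -ler_pdivrMr//.
    rewrite (le_trans _ (_ : n%:R <= _))//; last by rewrite ler_nat.
    by near: n; exact: nbhs_infty_ger.
  near=> n; rewrite /bump !step_ge1 ?mulr1//; near: n; apply: inf; rewrite subr_gt0//.
rewrite notin_setE/= in_itv/= => /negP; rewrite negb_and -!leNgt => h.
apply: cvg_near_cst; near=> n; rewrite /bump.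
by case/orP: h => h; [rewrite step_le0 ?mul0r//|rewrite [X in _ * X]step_le0 ?mulr0//];
  rewrite subr_le0 (le_trans _ ler01)// mulr_ge0_le0// subr_le0.
Unshelve. all: by end_near. Qed.

Lemma continuous_test (phi : R -> R) : test_function phi -> continuous phi.
Proof. by case=> + _ _ => d x; apply/differentiable_continuous/derivable1_diffP. Qed.

End SmoothStep.

Section Truncation.
Context {R : realType}.
Implicit Types e l s : R.

(** An approximation of the identity of [[0, l]] of class C^1 that is constant
    near both ends; its derivative is a trapezoid. *)
Definition trunc_id e l s : R :=
  (sqpos (s - e) - sqpos (s - 2 * e) - sqpos (s - (l - 2 * e))
    + sqpos (s - (l - e))) * (2 * e)^-1.

Definition dtrunc_id e l s : R :=
  (Num.max 0 (s - e) - Num.max 0 (s - 2 * e) - Num.max 0 (s - (l - 2 * e))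
    + Num.max 0 (s - (l - e))) * e^-1.

Lemma is_derive_trunc_id e l s : 0 < e ->
  is_derive s 1 (trunc_id e l) (dtrunc_id e l s).
Proof.
move=> e0; apply: (derive_eq (derive_mul (derive_add (derive_sub (derive_sub
  (is_derive_sqpos_shift e s) (is_derive_sqpos_shift (2 * e) s))
  (is_derive_sqpos_shift (l - 2 * e) s)) (is_derive_sqpos_shift (l - e) s))
  (derive_cst (2 * e)^-1 s))).
by rewrite /dtrunc_id; field; rewrite gt_eqF.
Qed.

Lemma continuous_dtrunc_id e l : continuous (dtrunc_id e l).
Proof.
move=> s; rewrite /continuous_at /dtrunc_id; apply: cvgM; last exact: cvg_cst.
apply: cvgD; last exact: continuous_max_shift.
apply: cvgB; last exact: continuous_max_shift.
by apply: cvgB; exact: continuous_max_shift.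
Qed.

Lemma trunc_id_left e l s : 0 < e -> 4 * e <= l -> s <= e ->
  trunc_id e l s = 0 /\ dtrunc_id e l s = 0.
Proof.
move=> e0 el se; rewrite /trunc_id /dtrunc_id /sqpos !max_l; [|lra..].
by rewrite expr0n/= !subrr !addr0 !mul0r.
Qed.

Lemma trunc_id_right e l s : 0 < e -> 4 * e <= l -> l - e <= s ->
  trunc_id e l s = l - 3 * e /\ dtrunc_id e l s = 0.
Proof.
move=> e0 el se; rewrite /trunc_id /dtrunc_id /sqpos !max_r; [|lra..].
by split; field; rewrite gt_eqF.
Qed.

Lemma dtrunc_id_mid e l s : 0 < e -> 4 * e <= l -> 2 * e <= s <= l - 2 * e ->
  dtrunc_id e l s = 1.
Proof.
move=> e0 el /andP[s1 s2]; rewrite /dtrunc_id.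
rewrite (@max_r _ _ 0 (s - e)); last lra.
rewrite (@max_r _ _ 0 (s - 2 * e)); last lra.
rewrite !max_l; [|lra..].
by field; rewrite gt_eqF.
Qed.

Lemma trunc_id_bounds e l s : 0 < e -> 4 * e <= l -> 0 <= s <= l ->
  `|trunc_id e l s - s| <= 3 * e /\ 0 <= dtrunc_id e l s <= 1.
Proof.
move=> e0 el /andP[s0 sl].
have e2 : 0 < 2 * e by lra.
suff [h1 [h2 h3]] : `|(sqpos (s - e) - sqpos (s - 2 * e) - sqpos (s - (l - 2 * e))
    + sqpos (s - (l - e))) - s * (2 * e)| <= 3 * e * (2 * e) /\
   0 <= Num.max 0 (s - e) - Num.max 0 (s - 2 * e) - Num.max 0 (s - (l - 2 * e))
    + Num.max 0 (s - (l - e)) /\ Num.max 0 (s - e) - Num.max 0 (s - 2 * e) -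
    Num.max 0 (s - (l - 2 * e)) + Num.max 0 (s - (l - e)) <= e.
  split.
    rewrite /trunc_id -[X in _ - X](mulfK (lt0r_neq0 e2)) -mulrBl normrM.
    by rewrite [`|(2 * e)^-1|]gtr0_norm ?invr_gt0// ler_pdivrMr.
  by rewrite /dtrunc_id divr_ge0 ?ler_pdivrMr ?mul1r// ltW.
rewrite /sqpos ler_norml.
have [h1|h1] := leP s e.
  by rewrite !max_l; [|lra..]; rewrite expr0n/=; split; [apply/andP; split; nra|lra].
rewrite (@max_r _ _ 0 (s - e)); last lra.
have [h2|h2] := leP s (2 * e).
  by rewrite !max_l; [|lra..]; rewrite expr0n/=; split; [apply/andP; split; nra|lra].
rewrite (@max_r _ _ 0 (s - 2 * e)); last lra.
have [h3|h3] := leP s (l - 2 * e).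
  by rewrite !max_l; [|lra..]; rewrite expr0n/=; split; [apply/andP; split; nra|lra].
rewrite (@max_r _ _ 0 (s - (l - 2 * e))); last lra.
have [h4|h4] := leP s (l - e).
  by rewrite !max_l; [|lra..]; rewrite expr0n/=; split; [apply/andP; split; nra|lra].
rewrite max_r; last lra.
by split; [apply/andP; split; nra|lra].
Qed.

End Truncation.
(** * Charges are determined by test functions *)

Section ChargeExt.
Context {R : realType}.
Local Notation I01 := (`]0, 1[%classic : set R).
Local Notation chargeR := (charge (measurableTypeR R) R).
Local Open Scope ereal_scope.

Lemma measurable_continuous (f : R -> R) (A : set (measurableTypeR R)) :
  continuous f -> measurable_fun A f.
Proof. by move=> cf; apply: measurable_funTS; exact: continuous_measurable_fun. Qed.

Lemma measurable_bump (s t k : R) (A : set (measurableTypeR R)) : measurable_fun A (bump s t k).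
Proof.
have ms : measurable_fun [set: measurableTypeR R] (@step R).
  by apply: measurable_continuous => y; exact: is_derive_continuous (is_derive_step y).
apply: measurable_funTS; apply: measurable_funM; apply: (measurableT_comp ms);
  apply: measurable_funB => //; apply: measurable_funM => //; exact: measurable_funB.
Qed.

Lemma bounded_bump (s t k : R) (A : set (measurableTypeR R)) : bounded_on A (bump s t k).
Proof.
by exists 1%R => x _; have /andP[b0 b1] := bump_itv s t k x; rewrite ger0_norm.
Qed.

Lemma cvg_integral_bump (m : {finite_measure set (measurableTypeR R) -> \bar R}) (s t : R) :
  \int[m]_(x in I01) (bump s t n.+1%:R x)%:E @[n --> \oo] --> m (`]s, t[%classic `&` I01).
Proof.
have mI := @measurable_I01 R.
have mi : measurable_fun I01 (fun x => (\1_(`]s, t[%classic : set R) x : R)%:E).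
  by apply/measurable_EFinP; apply: measurable_funTS; exact: measurable_indic.
have mI1 : m I01 < +oo by rewrite ltey_eq fin_num_measure.
have mb n : measurable_fun I01 (fun x => (bump s t n.+1%:R x)%:E).
  by apply/measurable_EFinP; exact: measurable_bump.
have cb : {ae m, forall x, I01 x -> (bump s t n.+1%:R x)%:E @[n --> \oo] -->
    (\1_(`]s, t[%classic : set R) x : R)%:E}.
  by apply: aeW => x _; apply: cvg_EFin; [exact: nearW|exact: cvg_bump].
have i1 : m.-integrable I01 (cst 1).
  apply: (@bounded_on_integrable _ _ _ m I01 (cst 1%R)) => //.
  by exists 1%R => x _; rewrite normr1.
have le1 : {ae m, forall x n, I01 x -> `|(bump s t n.+1%:R x)%:E| <= cst 1 x}.
  apply: aeW => x n _; have /andP[b0 b1] := bump_itv s t n.+1%:R x.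
  by rewrite /= lee_fin ger0_norm.
have [_ _] := @dominated_convergence _ (measurableTypeR R) R m I01 mI _ _ (cst 1) mb mi cb i1 le1.
by rewrite integral_indic.
Qed.

(** Bumps converge to the indicators of open intervals, which form a
    generating family closed under intersection. *)
Lemma charge_ext (nu1 nu2 : chargeR) :
  (forall phi : R -> R, test_function phi ->
    charge_integral nu1 I01 phi = charge_integral nu2 I01 phi) ->
  forall B : set R, measurable B -> B `<=` I01 -> nu1 B = nu2 B.
Proof.
move=> E.
have mI := @measurable_I01 R.
pose M1 := cross nu1 nu2; pose M2 := cross nu2 nu1.
have key (s t k : R) : (0 <= s)%R -> (t <= 1)%R -> (0 < k)%R ->
    \int[M1]_(x in I01) (bump s t k x)%:E = \int[M2]_(x in I01) (bump s t k x)%:E.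
  move=> s0 t1 k0; apply: integral_cross => //.
  - exact: measurable_bump.
  - exact: bounded_bump.
  - exact: E (test_function_bump s0 t1 k0).
have oo (s t : R) : M1 (`]s, t[%classic `&` I01) = M2 (`]s, t[%classic `&` I01).
  have -> : `]s, t[%classic `&` I01 = `]Num.max 0%R s, Num.min 1%R t[%classic `&` I01.
    apply/seteqP; split => x /=; rewrite !in_itv/= => -[/andP[a b] /andP[c e]].
      by rewrite gt_max lt_min a b c e.
    by move: a b; rewrite gt_max lt_min => /andP[-> ->] /andP[-> ->].
  have c1 := @cvg_integral_bump M1 (Num.max 0%R s) (Num.min 1%R t).
  have c2 := @cvg_integral_bump M2 (Num.max 0%R s) (Num.min 1%R t).
  apply: (cvg_unique _ c1); last move: c2; first exact: ereal_hausdorff.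
  have -> // : (fun n => \int[M2]_(x in I01) (bump (Num.max 0%R s) (Num.min 1%R t) n.+1%:R x)%:E)
    = (fun n => \int[M1]_(x in I01) (bump (Num.max 0%R s) (Num.min 1%R t) n.+1%:R x)%:E).
  by apply/funext => n; rewrite key// ?le_max ?lexx// ge_min lexx.
have eqM B : measurable B -> M1 (B `&` I01) = M2 (B `&` I01).
  move=> mB.
  pose m1 : {measure set (measurableTypeR R) -> \bar R} := mrestr M1 mI.
  pose m2 : {measure set (measurableTypeR R) -> \bar R} := mrestr M2 mI.
  suff : m1 B = m2 B by [].
  apply: (@measure_unique _ R (measurableTypeR R) (@RGenOpens.G R)
    (fun n => `](- n%:R)%R, n%:R[%classic) _ _ _ _ m1 m2) => //.
  - exact: RGenOpens.measurableE.
  - move=> _ _ [a [b ->]] [c [e ->]]; exists (Num.max a c), (Num.min b e).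
    apply/seteqP; split => x /=; rewrite !in_itv/= gt_max lt_min.
      by move=> [/andP[-> ->] /andP[-> ->]].
    by move=> /andP[/andP[-> ->] /andP[-> ->]].
  - by move=> n; exists (- n%:R)%R, n%:R.
  - apply/seteqP; split => // x _; exists (Num.bound `|x|) => //=; rewrite in_itv/= -ltr_norml.
    by apply: archi_boundP.
  - by move=> _ [a [b ->]]; exact: oo.
  - by move=> n; rewrite ltey_eq fin_num_measure.
move=> B mB BI; have := eqM B mB; rewrite (setIidl BI) => MB.
exact: charge_cross.
Qed.

End ChargeExt.
(** * The fundamental theorem of calculus with integrable singularities *)

Section FTCOpen.
Context {R : realType}.
Local Notation leb := (@lebesgue_measure R).
Variables (f G : R -> R) (a b : R).
Hypotheses (ab : a < b) (cG : continuous G).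
Hypothesis dG : forall x : R, a < x < b -> is_derive x 1 G (f x).
Hypothesis cf : forall x : R, a < x < b -> {for x, continuous f}.

(* The denominator is at least [3] so that the subintervals [J n] have nonempty
   interior. *)
Let e (n : nat) : R := (b - a) / n.+3%:R.

Let e_gt0 n : 0 < e n.
Proof. by rewrite divr_gt0// subr_gt0. Qed.

Let e_lt n : a + e n < b - e n.
Proof.
have : e n * 3 <= b - a.
  by rewrite /e mulrAC ler_pdivrMr// ler_pM2l ?subr_gt0// ler_nat.
have := e_gt0 n; lra.
Qed.

Let J n : set R := `[a + e n, b - e n]%classic.

Let J_sub n : J n `<=` `]a, b[.
Proof.
move=> x; rewrite /J /= !in_itv/= => /andP[ax xb].
have := e_gt0 n; have := e_lt n; rewrite -/(e n) in ax xb *; lra.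
Qed.

Let cvg_e : e n @[n --> \oo] --> (0 : R).
Proof.
rewrite (_ : 0 = (b - a) * 0); last by rewrite mulr0.
apply: cvgM; first exact: cvg_cst.
have h : (n.+1%:R : R)^-1 @[n --> \oo] --> (0 : R) by exact: cvg_harmonic.
have := h; rewrite -(cvg_shiftn 2) => h'.
have -> // : (fun n => (n.+3%:R : R)^-1) = (fun n => (n + 2).+1%:R^-1).
by apply/funext => n; rewrite addn2.
Qed.

Let J_near (x : R) : a < x < b -> \forall n \near \oo, J n x.
Proof.
move=> /andP[ax xb]; have m0 : 0 < Num.min (x - a) (b - x).
  by rewrite lt_min !subr_gt0 ax xb.
have /cvgrPdist_lt/(_ _ m0) h := cvg_e.
near=> n.
have : `|0 - e n| < Num.min (x - a) (b - x).
  by near: n; exact: h.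
rewrite sub0r normrN gtr0_norm// lt_min => /andP[h1 h2].
rewrite /J /= in_itv/=; lra.
Unshelve. all: by end_near. Qed.

Let J_integral n : (\int[leb]_(x in J n) (f x)%:E = (G (b - e n) - G (a + e n))%:E)%E.
Proof.
have cJ : {within J n, continuous f}.
  apply: within_continuous => x /(@J_sub n); rewrite /= in_itv/=; exact: cf.
have iJ : leb.-integrable (J n) (EFin \o f).
  by apply: continuous_compact_integrable => //; exact: segment_compact.
rewrite -[LHS]fineK; last by apply: integrable_fin_num => //; exact: measurable_itv.
congr EFin; apply: (@Rintegral_FTC2 _ f G); first exact: ltW.
- move=> x xJ; apply: cf; have := @J_sub n x; rewrite /J /= !in_itv/=; exact.
- move=> x xJ; apply: dG; have := @J_sub n x; rewrite /J /= !in_itv/=; exact.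
Qed.

Let cvg_G : (G (b - e n) - G (a + e n))%:E @[n --> \oo] --> (G b - G a)%:E.
Proof.
apply: cvg_EFin; first exact: nearW.
apply: cvgB.
  apply: (@cvg_comp _ _ _ (fun n => b - e n) G _ (nbhs b)); last exact: cG.
  suff : b - e n @[n --> \oo] --> b - 0 by rewrite subr0.
  by apply: cvgB; [exact: cvg_cst|exact: cvg_e].
apply: (@cvg_comp _ _ _ (fun n => a + e n) G _ (nbhs a)); last exact: cG.
suff : a + e n @[n --> \oo] --> a + 0 by rewrite addr0.
by apply: cvgD; [exact: cvg_cst|exact: cvg_e].
Qed.

Lemma open_measurable_continuous : measurable_fun `]a, b[ f.
Proof.
apply: open_continuous_measurable_fun; first exact: interval_open.
by move=> x; rewrite inE/= in_itv/=; exact: cf.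
Qed.

(** The derivative of the candidate is unbounded near its jump, so the theorem
    is applied on compact subintervals that exhaust the open interval. *)
Lemma FTC_open : leb.-integrable `]a, b[ (EFin \o f) ->
  (\int[leb]_(x in `]a, b[) (f x)%:E = (G b - G a)%:E)%E.
Proof.
move=> fi; have mf := measurable_int _ fi.
have mJ n : measurable (J n) by exact: measurable_itv.
have mfJ n : measurable_fun `]a, b[ ((EFin \o f) \_ (J n)).
  by apply/measurable_restrict => //; apply: measurable_funS mf => //; exact: subIsetl.
have cvgf : {ae leb, forall x, `]a, b[%classic x ->
    ((EFin \o f) \_ (J n)) x @[n --> \oo] --> (EFin \o f) x}.
  apply: aeW => x; rewrite /= in_itv/= => /J_near xJ; apply: cvg_near_cst.
  by near=> n; rewrite patchE mem_set//; near: n.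
have domf : {ae leb, forall x n, `]a, b[%classic x ->
    (`|((EFin \o f) \_ (J n)) x| <= `|(EFin \o f) x|)%E}.
  by apply: aeW => x n _; rewrite patchE; case: ifPn => _ //; rewrite abse0 abse_ge0.
have [_ _] := @dominated_convergence _ (measurableTypeR R) R leb `]a, b[%classic
  (measurable_itv _) _ _ (fun x => `|(EFin \o f) x|%E) mfJ mf cvgf (integrable_abse fi) domf.
have -> : (fun n => (\int[leb]_(x in `]a, b[) ((EFin \o f) \_ (J n)) x)%E) =
    (fun n => (G (b - e n) - G (a + e n))%:E).
  apply/funext => n; rewrite -J_integral -integral_mkcondr.
  by congr (integral _ _ _); apply: setIidr; exact: J_sub.
by move=> h; exact: (cvg_unique _ h cvg_G).
Unshelve. all: by end_near. Qed.

(** On compact subintervals the integral is an increment of [G], which stays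
    bounded; monotone convergence concludes. *)
Lemma nonneg_derivative_integrable : (forall x : R, a < x < b -> 0 <= f x) ->
  leb.-integrable `]a, b[ (EFin \o f).
Proof.
move=> f0; have mf := open_measurable_continuous.
apply/integrableP; split; first exact/measurable_EFinP.
have -> : (\int[leb]_(x in `]a, b[) `|(EFin \o f) x| = \int[leb]_(x in `]a, b[) (EFin \o f) x)%E.
  by apply: eq_integral => x; rewrite inE/= in_itv/= => xab; rewrite ger0_norm// f0.
have UJ : \bigcup_n J n = `]a, b[%classic.
  apply/seteqP; split => x; first by move=> [n _]; exact: J_sub.
  by rewrite /= in_itv/= => /J_near[n _ h]; exists n => //; exact: (h n (leqnn n)).
have h : (\int[leb]_(x in J i) (EFin \o f) x @[i --> \oo] -->
    \int[leb]_(x in \bigcup_i J i) (EFin \o f) x)%E.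
  apply: ge0_nondecreasing_set_cvg_integral.
  - move=> m n mn; apply/subsetPset => x; rewrite /J /= !in_itv/= => /andP[h1 h2].
    have enm : e n <= e m.
      by rewrite /e ler_pM2l ?subr_gt0// lef_pV2 ?posrE// ler_nat !ltnS.
    by apply/andP; split; lra.
  - by move=> i; exact: measurable_itv.
  - by move=> i; apply/measurable_EFinP; apply: measurable_funS mf => //; exact: J_sub.
  - by move=> i x /J_sub; rewrite /= in_itv/= lee_fin; exact: f0.
have h' : (\int[leb]_(x in J i) (EFin \o f) x @[i --> \oo] --> (G b - G a)%:E)%E.
  by under eq_fun do rewrite J_integral; exact: cvg_G.
have := cvg_unique _ h h'; rewrite UJ => -> //.
exact: ltry.
Qed.

End FTCOpen.
(** * Integrals over the two halves of the unit interval *)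

Section Halves.
Context {R : realType}.
Local Notation leb := (@lebesgue_measure R).
Local Notation I01 := (`]0, 1[%classic : set R).
Local Notation IL := (`]0, 2^-1[%classic : set R).
Local Notation IR := (`]2^-1, 1[%classic : set R).
Local Open Scope ereal_scope.

Lemma half_gt0 : (0 < 2^-1 :> R)%R. Proof. by rewrite invr_gt0. Qed.
Lemma half_lt1 : (2^-1 < 1 :> R)%R. Proof. by rewrite invf_lt1// ltr1n. Qed.

Lemma integral_halves (h : R -> \bar R) :
  measurable_fun (IL : set (measurableTypeR R)) h ->
  measurable_fun (IR : set (measurableTypeR R)) h ->
  measurable_fun (I01 : set (measurableTypeR R)) h /\
  \int[leb]_(x in I01) h x = \int[leb]_(x in IL) h x + \int[leb]_(x in IR) h x.
Proof.
move=> ml mr; have h0 := half_gt0; have h1 := half_lt1.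
have ml' : measurable_fun (`]0%R, 2^-1%R] : set (measurableTypeR R)) h.
  by apply/emeasurable_fun_itv_bndo_bndcP.
have IE : I01 = `]0%R, 2^-1%R] `|` IR.
  by rewrite -itv_bndbnd_setU// bnd_simp ltW.
have mU : measurable_fun (`]0%R, 2^-1%R] `|` IR : set (measurableTypeR R)) h.
  by apply/measurable_funU; [exact: measurable_itv..|split].
rewrite IE; split => //.
rewrite integral_setU//; first by rewrite -[in LHS]integral_itv_bndo_bndc.
apply/disj_setPS => x [/=]; rewrite !in_itv/= => /andP[_ x1] /andP[x2 _].
by move: (lt_le_trans x2 x1); rewrite ltxx.
Qed.

Lemma glue_halves (h hl hr : R -> R) :
  leb.-integrable IL (EFin \o hl) -> leb.-integrable IR (EFin \o hr) ->
  (forall x : R, (0 < x < 2^-1)%R -> h x = hl x) ->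
  (forall x : R, (2^-1 < x < 1)%R -> h x = hr x) ->
  leb.-integrable I01 (EFin \o h) /\
  \int[leb]_(x in I01) (h x)%:E =
    \int[leb]_(x in IL) (hl x)%:E + \int[leb]_(x in IR) (hr x)%:E.
Proof.
move=> il ir hlE hrE.
have eqL x : x \in IL -> (EFin \o hl) x = (EFin \o h) x.
  by rewrite inE/= in_itv/= => xI; rewrite /= hlE.
have eqR x : x \in IR -> (EFin \o hr) x = (EFin \o h) x.
  by rewrite inE/= in_itv/= => xI; rewrite /= hrE.
have ml : measurable_fun (IL : set (measurableTypeR R)) (EFin \o h).
  by apply: eq_measurable_fun (measurable_int _ il) => x; rewrite inE => ?; apply: eqL; rewrite inE.
have mr : measurable_fun (IR : set (measurableTypeR R)) (EFin \o h).
  by apply: eq_measurable_fun (measurable_int _ ir) => x; rewrite inE => ?; apply: eqR; rewrite inE.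
have [mh ->] := integral_halves ml mr; split; last first.
  by congr (_ + _); apply: eq_integral => x xI; [exact: (esym (eqL x xI))|exact: (esym (eqR x xI))].
apply/integrableP; split => //.
have [|| _ ->] := @integral_halves (fun x => `|(EFin \o h) x|).
- exact: measurableT_comp.
- exact: measurableT_comp.
have -> : \int[leb]_(x in IL) `|(EFin \o h) x| = \int[leb]_(x in IL) `|(EFin \o hl) x|.
  by apply: eq_integral => x /eqL <-.
have -> : \int[leb]_(x in IR) `|(EFin \o h) x| = \int[leb]_(x in IR) `|(EFin \o hr) x|.
  by apply: eq_integral => x /eqR <-.
by move/integrableP : il => [_ ?]; move/integrableP : ir => [_ ?]; exact: lte_add_pinfty.
Qed.

Lemma continuous_integrable_oo (f : R -> R) (a b : R) : continuous f ->
  leb.-integrable `]a, b[ (EFin \o f).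
Proof.
move=> cf; have i := continuous_integrable a b cf.
by apply: (integrableS _ _ _ i); [exact: measurable_itv..|exact: subset_itv_oo_cc].
Qed.

Lemma integrable_bounded_mul (A : set (measurableTypeR R)) (phi h : R -> R) :
  measurable A -> measurable_fun A phi -> bounded_on A phi ->
  leb.-integrable A (EFin \o h) -> leb.-integrable A (EFin \o (fun x => phi x * h x)%R).
Proof.
move=> mA mphi [M phiM] ih.
have mh := measurable_int _ ih.
apply: (@le_integrable _ _ _ _ _ mA _ (fun x => M%:E * (EFin \o h) x)).
- apply/measurable_EFinP; apply: measurable_funM => //; exact/measurable_EFinP.
- move=> x Ax; rewrite /= normrM lee_fin normrM ler_wpM2r//.
  by rewrite (le_trans (phiM x Ax))// ler_norm.
- exact: integrableZl.
Qed.

End Halves.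
(** * Derivatives of functions of bounded variation *)

Section Parts.
Context {R : realType}.
Local Notation leb := (@lebesgue_measure R).
Local Notation I01 := (`]0, 1[%classic : set R).
Local Notation chargeR := (charge (measurableTypeR R) R).
Implicit Types (w g : R -> R) (nu : chargeR).
Local Open Scope ereal_scope.

Lemma tot_var0 nu (A B : set (measurableTypeR R)) : measurable A -> measurable B ->
  B `<=` A -> tot_var nu A = 0 -> nu B = 0.
Proof.
move=> mA mB BA.
have -> : tot_var nu A = pos_part nu A + neg_part nu A by [].
move/eqP; rewrite padde_eq0 ?measure_ge0// => /andP[/eqP pA /eqP qA].
have sub0 (m : {measure set (measurableTypeR R) -> \bar R}) : m A = 0 -> m B = 0.
  by move=> m0; apply/eqP; rewrite eq_le measure_ge0 andbT -m0 le_measure// inE.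
by rewrite charge_jordan// !sub0// sube0.
Qed.

(** Both carriers of the singular parts are null sets, and off these carriers
    the charge is the integral of either density. *)
Lemma lebesgue_decomposition_unique nu (nu' : chargeR) g (g' : R -> R) (nus nus' : chargeR) :
  lebesgue_decomposition nu g nus -> lebesgue_decomposition nu' g' nus' ->
  (forall B : set R, measurable B -> B `<=` I01 -> nu B = nu' B) ->
  ae_eq leb I01 (EFin \o g) (EFin \o g') /\
  forall B : set R, measurable B -> B `<=` I01 -> nus B = nus' B.
Proof.
move=> [ig [N [mN NI N0 tN]] nuE] [ig' [N' [mN' NI' N0' tN']] nuE'] nunu'.
have mI := @measurable_I01 R.
have mNN : measurable (N `|` N' : set (measurableTypeR R)) by exact: measurableU.
have NN0 : leb (N `|` N') = 0.
  by apply/eqP; rewrite eq_le measure_ge0 andbT (le_trans (measureU2 _ _ _))//= N0 N0' adde0.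
have int_eq (E : set (measurableTypeR R)) : E `<=` I01 -> measurable E ->
    \int[leb]_(x in E) (g x)%:E = \int[leb]_(x in E) (g' x)%:E.
  move=> EI mE.
  have mD : measurable (E `\` (N `|` N')) by exact: measurableD.
  have DI : E `\` (N `|` N') `<=` I01 by move=> x [/EI].
  have off h (nu0 nus0 : chargeR) (N1 : set R) : leb.-integrable I01 (EFin \o h) ->
      measurable (N1 : set (measurableTypeR R)) ->
      N1 `<=` N `|` N' -> tot_var nus0 (I01 `\` N1) = 0 ->
      (forall B : set R, measurable B -> B `<=` I01 ->
        nu0 B = \int[leb]_(x in B) (h x)%:E + nus0 B) ->
      \int[leb]_(x in E) (h x)%:E = nu0 (E `\` (N `|` N')).
    move=> ih mN1 sN t0 nu0E; rewrite nu0E//.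
    rewrite (@tot_var0 nus0 (I01 `\` N1))// ?adde0; last 2 first.
    - exact: measurableD.
    - by move=> x [/EI Ix h1]; split => // /sN.
    apply: negligible_integral => //.
    exact: (integrableS mI mE EI ih).
  rewrite (off _ _ _ _ ig mN (@subsetUl _ N N') tN nuE).
  rewrite (off _ _ _ _ ig' mN' (@subsetUr _ N N') tN' nuE').
  exact: nunu'.
split.
  apply: integral_ae_eq => //; first exact: measurable_int ig'.
move=> B mB BI.
have iB := integrableS mI mB BI ig.
have iB' := integrableS mI mB BI ig'.
have := nunu' B mB BI; rewrite nuE// nuE'// int_eq//.
set I := \int[leb]_(x in B) _.
have fI : I \is a fin_num by exact: integrable_fin_num.
by move=> /(congr1 (fun z => z - I)); rewrite ![I + _]addeC !addeK.
Qed.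

Lemma derivative_pairP w : BV w -> derivative_parts w (derivative_pair w).
Proof.
move=> [_ [nu dnu]]; rewrite /derivative_pair; case: pselect => [h|h].
  exact: (svalP (cid h)).
have [g [nus dec]] := lebesgue_decomposition_exists nu.
by case: h; exists (g, nus), nu; split.
Qed.

Lemma distributional_derivative_unique w nu (nu' : chargeR) :
  distributional_derivative w nu -> distributional_derivative w nu' ->
  forall B : set R, measurable B -> B `<=` I01 -> nu B = nu' B.
Proof.
move=> d d'; apply: charge_ext => phi tphi.
by apply: oppe_inj; rewrite -d// d'.
Qed.

End Parts.
(** * The candidate and its dual field *)

Section Candidate.
Context {R : realType}.
Local Notation leb := (@lebesgue_measure R).
Local Notation I01 := (`]0, 1[%classic : set R).
Local Notation IL := (`]0, 2^-1[%classic : set R).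
Local Notation IR := (`]2^-1, 1[%classic : set R).
Local Notation chargeR := (charge (measurableTypeR R) R).

Variables (L lam M : R) (sigma V q : R -> R).
Hypotheses (L0 : 0 < L) (lam0 : 0 < lam).
Hypotheses (csigma : continuous sigma) (cV : continuous V).
Hypothesis sigma_left : forall t : R, t <= 0 -> sigma t = 0.
Hypothesis sigma_right : forall t : R, 2^-1 <= t -> sigma t = L.
Hypothesis sigma_itv : forall t : R, 0 < t < 2^-1 -> 0 < sigma t < L.
Hypothesis dsigma : forall t : R, 0 < t < 2^-1 -> is_derive t 1 sigma (lam * V t).
Hypothesis dV : forall t : R, 0 < t < 2^-1 -> is_derive t 1 V (q t).
Hypothesis cq : forall t : R, 0 < t < 2^-1 -> {for t, continuous q}.
Hypothesis q_ge0 : forall t : R, 0 < t < 2^-1 -> 0 <= q t.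
Hypotheses (VM : forall t : R, 0 < V t <= M) (Mhalf : M < 2^-1).

(** Off [1/2] the candidate is point symmetric about [(1/2, 1/2)], its dual field is
    symmetric about [1/2]. *)
Definition cand (t : R) : R := if t <= 2^-1 then V t else 1 - V (1 - t).
Definition cand_d (t : R) : R := if t < 2^-1 then q t else q (1 - t).
Definition dual (t : R) : R := sigma t + sigma (1 - t) - L.
Definition dual_d (t : R) : R := if t <= 2^-1 then lam * V t else - (lam * V (1 - t)).
Definition gap : R := 1 - 2 * V 2^-1.

Lemma gap_gt0 : 0 < gap.
Proof. by rewrite /gap subr_gt0; have /andP[_ h] := VM 2^-1; have := Mhalf; lra. Qed.

Let refl (t : R) : 2^-1 < t < 1 -> 0 < 1 - t < 2^-1.
Proof. by have := @half_lt1 R; have := @half_gt0 R => ? ? /andP[? ?]; lra. Qed.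

Let continuous_refl (f : R -> R) (t : R) : {for 1 - t, continuous f} ->
  {for t, continuous (fun x : R => f (1 - x))}.
Proof.
move=> cf; apply: (@continuous_comp _ _ _ (fun x : R => 1 - x) f) => //.
by apply: cvgB; [exact: cvg_cst|exact: cvg_id].
Qed.

Let derive_refl (f : R -> R) (t l : R) : is_derive (1 - t) 1 f l ->
  is_derive t 1 (fun x : R => f (1 - x)) (- l).
Proof.
move=> df; apply: (derive_eq (@derive_comp _ f (fun x : R => 1 - x) t _ _ df
  (derive_sub (derive_cst 1 t) (derive_id t)))).
by rewrite sub0r mulrN1.
Qed.

Let derive_V2 (t : R) : 2^-1 < t < 1 -> is_derive t 1 (fun x : R => 1 - V (1 - x)) (q (1 - t)).
Proof.
move=> /refl t01; apply: (derive_eq (derive_sub (derive_cst 1 t) (derive_refl (dV t01)))).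
by rewrite sub0r opprK.
Qed.

Let continuous_V2 : continuous (fun x : R => 1 - V (1 - x)).
Proof.
by move=> t; apply: cvgB; [exact: cvg_cst|apply: continuous_refl; exact: cV].
Qed.

Lemma q_integrable : leb.-integrable IL (EFin \o q).
Proof.
exact: (@nonneg_derivative_integrable _ q V 0 2^-1 half_gt0 cV dV cq q_ge0).
Qed.

Lemma q_refl_integrable : leb.-integrable IR (EFin \o (fun t : R => q (1 - t))).
Proof.
apply: (@nonneg_derivative_integrable _ _ _ 2^-1 1 half_lt1 continuous_V2 derive_V2).
- by move=> t /refl t01; apply: continuous_refl; exact: cq.
- by move=> t /refl; exact: q_ge0.
Qed.

Let half_not (t : R) : 2^-1 < t < 1 -> (t <= 2^-1) = false /\ (t < 2^-1) = false.
Proof. by case/andP => h _; rewrite leNgt h ltNge (ltW h). Qed.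

Lemma cand_d_integrable : leb.-integrable I01 (EFin \o cand_d).
Proof.
apply: (proj1 (@glue_halves _ cand_d q (fun t : R => q (1 - t)) q_integrable q_refl_integrable _ _)).
- by move=> t /andP[_ th]; rewrite /cand_d th.
- by move=> t /half_not[_ e]; rewrite /cand_d e.
Qed.

Lemma cand_integrable : leb.-integrable I01 (EFin \o cand).
Proof.
apply: (proj1 (@glue_halves _ cand V (fun t : R => 1 - V (1 - t)) _ _ _ _)).
- exact: continuous_integrable_oo.
- exact: continuous_integrable_oo.
- by move=> t /andP[_ th]; rewrite /cand ltW.
- by move=> t /half_not[e _]; rewrite /cand e.
Qed.

Lemma test_bounded (phi : R -> R) : test_function phi -> bounded_on I01 phi.
Proof.
move=> tphi; have cphi := continuous_test tphi.
have cn : {within `[0, 1], continuous (fun x : R => `|phi x|)}.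
  by apply: within_continuous => x _; apply: cvg_norm; exact: cphi.
have [c _ hc] := @EVT_max R _ 0 1 ler01 cn.
exists `|phi c| => x; rewrite /= in_itv/= => /andP[x0 x1].
by apply: hc; rewrite in_itv/= !ltW.
Qed.

Let mu_gap : {finite_measure set (measurableTypeR R) -> \bar R} :=
  mscale (NngNum (ltW gap_gt0)) (@dirac _ (measurableTypeR R) (2^-1 : R) R).

Lemma mu_gapE (B : set R) : mu_gap B = (gap * \1_B 2^-1)%:E.
Proof. by rewrite /mu_gap/= /mscale/= diracE indicE EFinM. Qed.

Lemma integral_mu_gap (phi : R -> R) : measurable_fun (I01 : set (measurableTypeR R)) phi ->
  bounded_on I01 phi ->
  (\int[mu_gap]_(x in I01) (phi x)%:E = (gap * phi 2^-1)%:E)%E.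
Proof.
move=> mphi bphi.
have mI : measurable (I01 : set (measurableTypeR R)) by exact: measurable_I01.
have half01 : I01 2^-1 by rewrite /= in_itv/= half_gt0 half_lt1.
transitivity (\int[mu_gap]_(x in I01) (cst (phi 2^-1)%:E x))%E; last first.
  rewrite integral_cst// [X in (_ * X)%E]mu_gapE indicE mem_set// mulr1 -EFinM.
  by rewrite mulrC.
apply: ae_eq_integral => //; first exact/measurable_EFinP.
exists (~` [set (2^-1 : R)]); split.
- by apply: measurableC; exact: measurable_set1.
- rewrite [LHS]mu_gapE indicE memNset ?mulr0//; exact.
- by move=> x h e; apply: h => _; rewrite /= e.
Qed.

(** Each half contributes a boundary term at [1/2]; their difference is the
    height of the jump. *)
Lemma cand_by_parts (phi : R -> R) : test_function phi ->
  (\int[leb]_(x in I01) (cand x * derive1 phi x)%:E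
    = - (\int[leb]_(x in I01) (phi x * cand_d x)%:E + (gap * phi 2^-1)%:E))%E.
Proof.
move=> tphi; have cphi := continuous_test tphi.
have [dphi cdphi [a [b [a0 b1 phi0]]]] := tphi.
have dphi' (t : R) : is_derive t 1 phi (derive1 phi t).
  by split=> //; rewrite derive1E.
have p0 : phi 0 = 0 by apply: phi0; rewrite in_itv/= negb_and -ltNge a0.
have p1 : phi 1 = 0 by apply: phi0; rewrite in_itv/= negb_and -!ltNge b1 orbT.
have mphi A : measurable_fun (A : set (measurableTypeR R)) phi by exact: measurable_continuous.
have [N phiN] := test_bounded tphi.
have iL : leb.-integrable IL (EFin \o (fun t : R => V t * derive1 phi t)).
  by apply: continuous_integrable_oo => t; apply: cvgM; [exact: cV|exact: cdphi].
have iR : leb.-integrable IR (EFin \o (fun t : R => (1 - V (1 - t)) * derive1 phi t)).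
  by apply: continuous_integrable_oo => t; apply: cvgM; [exact: continuous_V2|exact: cdphi].
have bL : bounded_on IL phi.
  exists N => x; rewrite /= in_itv/= => /andP[x0 x1]; apply: phiN.
  by rewrite /= in_itv/= x0 (lt_trans x1 half_lt1).
have bR : bounded_on IR phi.
  exists N => x; rewrite /= in_itv/= => /andP[x0 x1]; apply: phiN.
  by rewrite /= in_itv/= x1 (lt_trans half_gt0 x0).
have jL : leb.-integrable IL (EFin \o (fun t : R => phi t * q t)).
  by apply: integrable_bounded_mul => //; exact: q_integrable.
have jR : leb.-integrable IR (EFin \o (fun t : R => phi t * q (1 - t))).
  by apply: integrable_bounded_mul => //; exact: q_refl_integrable.
have EL : (\int[leb]_(x in IL) (V x * derive1 phi x)%:E
    + \int[leb]_(x in IL) (phi x * q x)%:E = (V 2^-1 * phi 2^-1)%:E)%E.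
  rewrite -integralD//; under eq_integral do rewrite -EFinD.
  have -> : V 2^-1 * phi 2^-1 = V 2^-1 * phi 2^-1 - V 0 * phi 0 by rewrite p0 mulr0 subr0.
  apply: (@FTC_open _ _ (fun t : R => V t * phi t) 0 2^-1 half_gt0) => //.
  - by move=> t; apply: cvgM; [exact: cV|exact: cphi].
  - move=> t t01; apply: (derive_eq (derive_mul (dV t01) (dphi' t))); ring.
  - move=> t t01; apply: cvgD; apply: cvgM; [exact: cV|exact: cdphi|exact: cphi|exact: cq].
  - by have := integrableD _ iL jL; apply.
have ER : (\int[leb]_(x in IR) ((1 - V (1 - x)) * derive1 phi x)%:E
    + \int[leb]_(x in IR) (phi x * q (1 - x))%:E = (- ((1 - V 2^-1) * phi 2^-1))%:E)%E.
  rewrite -integralD//; under eq_integral do rewrite -EFinD.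
  have -> : - ((1 - V 2^-1) * phi 2^-1) =
     (1 - V (1 - 1)) * phi 1 - (1 - V (1 - 2^-1)) * phi 2^-1.
    rewrite p1 mulr0 sub0r (_ : 1 - 2^-1 = 2^-1 :> R)//; by field.
  apply: (@FTC_open _ _ (fun t : R => (1 - V (1 - t)) * phi t) 2^-1 1 half_lt1) => //.
  - by move=> t; apply: cvgM; [exact: continuous_V2|exact: cphi].
  - move=> t t01; apply: (derive_eq (derive_mul (derive_V2 t01) (dphi' t))); ring.
  - move=> t t01; apply: cvgD; apply: cvgM; [exact: continuous_V2|exact: cdphi|exact: cphi|].
    by apply: continuous_refl; apply: cq; exact: refl.
  - by have := integrableD _ iR jR; apply.
have [||_ ->] := @glue_halves _ (fun x : R => cand x * derive1 phi x) _ _ iL iR.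
- by move=> t /andP[_ th]; rewrite /cand ltW.
- by move=> t /half_not[e _]; rewrite /cand e.
have [||_ ->] := @glue_halves _ (fun x : R => phi x * cand_d x) _ _ jL jR.
- by move=> t /andP[_ th]; rewrite /cand_d th.
- by move=> t /half_not[_ e]; rewrite /cand_d e.
have fin (A : set (measurableTypeR R)) (h : R -> R) : measurable A ->
    leb.-integrable A (EFin \o h) -> (\int[leb]_(x in A) (h x)%:E)%E \is a fin_num.
  by move=> mA ih; exact: integrable_fin_num.
have /fineK h1 := fin _ _ (measurable_itv _) iL.
have /fineK h2 := fin _ _ (measurable_itv _) iR.
have /fineK h3 := fin _ _ (measurable_itv _) jL.
have /fineK h4 := fin _ _ (measurable_itv _) jR.
rewrite /= in EL ER *; move: EL ER; rewrite -h1 -h2 -h3 -h4.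
move: (fine _) (fine _) (fine _) (fine _) => x1 x2 x3 x4.
rewrite -!EFinD -EFinN => -[e1] [e2]; congr EFin.
by rewrite /gap; lra.
Qed.

Lemma cand_d_restrict_integrable : leb.-integrable setT ((EFin \o cand_d) \_ I01).
Proof.
by apply/(integrable_mkcond _ (@measurable_I01 R)); exact: cand_d_integrable.
Qed.

Definition gap_charge : chargeR := charge_of_finite_measure mu_gap.

Definition cand_charge : chargeR :=
  cadd (induced_charge cand_d_restrict_integrable) gap_charge.

Lemma cand_chargeE (B : set R) : measurable B -> B `<=` I01 ->
  (cand_charge B = \int[leb]_(x in B) (cand_d x)%:E + gap_charge B)%E.
Proof.
move=> mB BI; rewrite /cand_charge/= /cadd; congr (_ + _)%E.
rewrite /induced_charge; apply: eq_integral => x; rewrite inE => /BI Ix.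
by rewrite patchE mem_set.
Qed.

Lemma gap_charge_integral (phi : R -> R) :
  measurable_fun (I01 : set (measurableTypeR R)) phi -> bounded_on I01 phi ->
  charge_integral gap_charge I01 phi = (gap * phi 2^-1)%:E.
Proof.
move=> mphi bphi.
by rewrite (@charge_integral_measure _ _ _ gap_charge mu_gap)// integral_mu_gap.
Qed.

Lemma cand_derivative : distributional_derivative cand cand_charge.
Proof.
move=> phi tphi; rewrite cand_by_parts//; congr (- _)%E; apply/esym.
have mI := @measurable_I01 R.
have mphi : measurable_fun (I01 : set (measurableTypeR R)) phi.
  by apply: measurable_continuous; exact: continuous_test.
have bphi := test_bounded tphi.
rewrite (@charge_integralD _ _ _ cand_charge (induced_charge cand_d_restrict_integrable) gap_charge)//.
congr (_ + _)%E; last exact: gap_charge_integral.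
apply: (@charge_integral_density _ _ _ leb) => //; first exact: cand_d_integrable.
move=> B mB BI; rewrite /= /induced_charge; apply: eq_integral => x; rewrite inE => /BI Ix.
by rewrite patchE mem_set.
Qed.

Lemma cand_BV : BV cand.
Proof.
by split; [exact: cand_integrable|exists cand_charge; exact: cand_derivative].
Qed.

Lemma gap_singular : singular_on01 gap_charge.
Proof.
exists [set (2^-1 : R)]; split.
- exact: measurable_set1.
- by move=> x ->; rewrite /= in_itv/= half_gt0 half_lt1.
- exact: lebesgue_measure_set1.
- rewrite (@tot_var_measure _ _ _ gap_charge mu_gap)//.
    by rewrite [LHS]mu_gapE indicE memNset ?mulr0// => -[_]; apply.
  by apply: measurableD; [exact: measurable_I01|exact: measurable_set1].
Qed.

Lemma cand_decomposition : lebesgue_decomposition cand_charge cand_d gap_charge.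
Proof.
split; [exact: cand_d_integrable|exact: gap_singular|exact: cand_chargeE].
Qed.

Lemma cand_parts : ae_eq leb I01 (EFin \o ac_density cand) (EFin \o cand_d) /\
  forall B : set R, measurable B -> B `<=` I01 -> singular_part cand B = gap_charge B.
Proof.
have [nu [dnu dec]] := derivative_pairP cand_BV.
apply: (lebesgue_decomposition_unique dec cand_decomposition).
exact: (distributional_derivative_unique dnu cand_derivative).
Qed.

Lemma tot_var_singular_cand : tot_var (singular_part cand) I01 = gap%:E.
Proof.
rewrite (@tot_var_measure _ _ _ _ mu_gap).
- by rewrite [LHS]mu_gapE indicE mem_set ?mulr1//= in_itv/= half_gt0 half_lt1.
- exact: measurable_I01.
- by move=> B mB BI; rewrite (proj2 cand_parts).
Qed.

(** ** The dual field *)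

Lemma sigma_range (t : R) : 0 <= sigma t <= L.
Proof.
have [t0|t0] := leP t 0; first by rewrite sigma_left// lexx ltW.
have [t1|t1] := leP 2^-1 t; first by rewrite sigma_right// lexx ltW.
by have /andP[h1 h2] := sigma_itv (introT andP (conj t0 t1)); rewrite !ltW.
Qed.

Lemma dualE (t : R) : dual t = if t <= 2^-1 then sigma t else sigma (1 - t).
Proof.
rewrite /dual; case: leP => h.
  rewrite [sigma (1 - t)]sigma_right ?addrK//.
  by move: h; rewrite -(lerD2r (- t)) subrr; lra.
by rewrite (sigma_right (ltW h)) addrAC subrr add0r.
Qed.

Lemma dual_range (t : R) : 0 <= dual t <= L.
Proof. by rewrite dualE; case: ifP => _; exact: sigma_range. Qed.

Lemma dual_half : dual 2^-1 = L.
Proof. by rewrite dualE lexx sigma_right. Qed.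

Lemma continuous_dual : continuous dual.
Proof.
move=> t; apply: cvgB; last exact: cvg_cst.
by apply: cvgD; [exact: csigma|apply: continuous_refl; exact: csigma].
Qed.

Let near_lt (t e : R) : sigma t < e -> \forall r \near t, sigma r < e.
Proof. exact: continuous_near_lt. Qed.

Let near_gt (t e : R) : e < sigma t -> \forall r \near t, e < sigma r.
Proof. exact: continuous_near_gt. Qed.

Let chi (e t : R) : R := trunc_id e L (sigma t).
Let dchi (e t : R) : R := dtrunc_id e L (sigma t) * (lam * V t).

Let dtrunc0 (e t : R) : 0 < e -> 4 * e <= L -> sigma t <= e \/ L - e <= sigma t ->
  dtrunc_id e L (sigma t) = 0.
Proof.
by move=> e0 eL [h|h]; [case: (trunc_id_left e0 eL h)|case: (trunc_id_right e0 eL h)].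
Qed.

(** Near the points where [sigma] is not known to be differentiable, the
    truncation is constant. *)
Lemma is_derive_chi (e t : R) : 0 < e -> 4 * e <= L ->
  is_derive t 1 (chi e) (dchi e t).
Proof.
move=> e0 eL.
have [h|h] := ltP (sigma t) e.
  rewrite /dchi dtrunc0//; last by left; exact: ltW.
  rewrite mul0r; apply: (near_eq_is_derive _ (derive_cst 0 t)).
  have hn : \forall r \near t, sigma r < e by exact: near_lt.
  near=> r; rewrite /chi (proj1 (trunc_id_left e0 eL _))// ltW//.
  by near: r; exact: hn.
have [h'|h'] := ltP (L - e) (sigma t).
  rewrite /dchi dtrunc0//; last by right; exact: ltW.
  rewrite mul0r; apply: (near_eq_is_derive _ (derive_cst (L - 3 * e) t)).
  have hn : \forall r \near t, L - e < sigma r by exact: near_gt.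
  near=> r; rewrite /chi (proj1 (trunc_id_right e0 eL _))// ltW//.
  by near: r; exact: hn.
have t01 : 0 < t < 2^-1.
  apply/andP; split; rewrite ltNge; apply/negP => ht.
    by move: h; rewrite sigma_left// leNgt e0.
  by move: h'; rewrite sigma_right// lerBrDr gerDl leNgt e0.
exact: (@derive_comp _ (trunc_id e L) sigma t _ _ (is_derive_trunc_id L (sigma t) e0) (dsigma t01)).
Unshelve. all: by end_near. Qed.

Lemma continuous_dchi (e : R) : continuous (dchi e).
Proof.
move=> t; apply: cvgM; last by apply: cvgM; [exact: cvg_cst|exact: cV].
by apply: (@continuous_comp _ _ _ sigma (dtrunc_id e L)); [exact: csigma|exact: continuous_dtrunc_id].
Qed.

(** The constant is the common value of [chi] on [[1/2, 1]], so that on either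
    half only one of the two terms survives. *)
Definition dual_approx (e t : R) : R := chi e t + chi e (1 - t) - (L - 3 * e).
Let ddual_approx (e t : R) : R := dchi e t - dchi e (1 - t).

Lemma is_derive_dual_approx (e t : R) : 0 < e -> 4 * e <= L ->
  is_derive t 1 (dual_approx e) (ddual_approx e t).
Proof.
move=> e0 eL; apply: (derive_eq (derive_sub (derive_add (is_derive_chi t e0 eL)
  (derive_refl (is_derive_chi (1 - t) e0 eL))) (derive_cst _ t))).
by rewrite subr0.
Qed.

Lemma test_function_dual_approx (e : R) : 0 < e -> 4 * e <= L ->
  test_function (dual_approx e).
Proof.
move=> e0 eL.
have [d d0 hd] : exists2 d : R, 0 < d & forall t, t < d -> sigma t <= e.
  have s00 : sigma 0 < e by rewrite sigma_left.
  have [d /= d0 hd] := near_lt s00.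
  exists d => // t td; have [t0|t0] := leP t 0; first by rewrite sigma_left// ltW.
  by apply/ltW/hd; rewrite /= sub0r normrN gtr0_norm.
pose a := Num.min d 2^-1.
have a0 : 0 < a by rewrite lt_min d0 half_gt0.
have ah : a <= 2^-1 by rewrite ge_min lexx orbT.
have ad : a <= d by rewrite ge_min lexx.
have right (r : R) : 2^-1 <= r -> chi e r = L - 3 * e.
  by move=> r1; rewrite /chi sigma_right// (proj1 (trunc_id_right e0 eL _))// lerBlDr lerDl ltW.
have left (r : R) : r < a -> chi e r = 0.
  by move=> ra; rewrite /chi (proj1 (trunc_id_left e0 eL _))// hd// (lt_le_trans ra).
apply: (@test_functionI _ _ (ddual_approx e) a (1 - a)) => //.
- by move=> t; exact: is_derive_dual_approx.
- move=> t; apply: cvgB; first exact: continuous_dchi.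
  by apply: continuous_refl; exact: continuous_dchi.
- by rewrite ltrBlDr ltrDl.
- move=> t [ta|ta]; rewrite /dual_approx.
    rewrite left// right ?add0r ?subrr//.
    rewrite lerBrDl -lerBrDr (_ : 1 - 2^-1 = 2^-1); last by field.
    by rewrite (le_trans (ltW ta)).
  rewrite [chi e (1 - t)]left; last by rewrite ltrBlDr -ltrBlDl.
  rewrite right ?addr0 ?subrr//.
  apply: (le_trans _ (ltW ta)); rewrite lerBrDl -lerBrDr (_ : 1 - 2^-1 = 2^-1)//.
  by field.
Qed.

Lemma dual_approx_dist (e t : R) : 0 < e -> 4 * e <= L ->
  `|dual_approx e t - dual t| <= 9 * e.
Proof.
move=> e0 eL.
have [] := trunc_id_bounds e0 eL (sigma_range t).
have [] := trunc_id_bounds e0 eL (sigma_range (1 - t)).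
rewrite -/(chi e t) -/(chi e (1 - t)) !ler_norml => /andP[a1 a2] _ /andP[b1 b2] _.
by rewrite /dual_approx /dual; apply/andP; split; lra.
Qed.

Lemma ddual_approx_bound (e t : R) : 0 < e -> 4 * e <= L ->
  `|ddual_approx e t| <= 2 * (lam * M).
Proof.
move=> e0 eL.
have b r : `|dchi e r| <= lam * M.
  have [_ /andP[d0 d1]] := trunc_id_bounds e0 eL (sigma_range r).
  have /andP[v0 v1] := VM r.
  rewrite /dchi ger0_norm; last by apply: mulr_ge0 => //; apply: mulr_ge0; exact: ltW.
  rewrite -[leRHS]mul1r; apply: ler_pM => //; last by rewrite ler_pM2l.
  by apply: mulr_ge0; exact: ltW.
rewrite /ddual_approx (le_trans (ler_normB _ _))//.
by have := b t; have := b (1 - t); lra.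
Qed.

(* The factor [4] leaves room for the four breakpoints of [trunc_id] in
   [[0, L]]. *)
Let eps (n : nat) : R := L / (4 * n.+1%:R).

Let eps_gt0 n : 0 < eps n.
Proof. by rewrite divr_gt0// mulr_gt0. Qed.

Let eps_le n : 4 * eps n <= L.
Proof.
rewrite /eps mulrCA ler_piMr ?(ltW L0)// invfM mulrA divff// mul1r invf_le1//.
by rewrite ler1n.
Qed.

Let cvg_eps : eps n @[n --> \oo] --> (0 : R).
Proof.
have -> : eps = (fun n => L / 4 * n.+1%:R^-1).
  by apply/funext => n; rewrite /eps invfM mulrA.
rewrite (_ : 0 = L / 4 * 0); last by rewrite mulr0.
by apply: cvgM; [exact: cvg_cst|exact: cvg_harmonic].
Qed.

Let eps_small (r : R) : 0 < r -> \forall n \near \oo, eps n < r.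
Proof.
move=> r0; have /cvgrPdist_lt/(_ _ r0) h := cvg_eps.
near=> n; have : `|0 - eps n| < r by near: n; exact: h.
by rewrite sub0r normrN gtr0_norm.
Unshelve. all: by end_near. Qed.

Let cvg_dual_approx (t : R) : dual_approx (eps n) t @[n --> \oo] --> dual t.
Proof.
apply/cvgrPdist_lt => r r0; have r9 : 0 < r / 9 by rewrite divr_gt0.
near=> n; rewrite distrC.
apply: (le_lt_trans (dual_approx_dist t (eps_gt0 n) (eps_le n))).
have : eps n < r / 9 by near: n; exact: eps_small.
by rewrite ltr_pdivlMr// mulrC.
Unshelve. all: by end_near. Qed.

Let cvg_dtrunc (t : R) : 0 < t < 2^-1 ->
  \forall n \near \oo, dtrunc_id (eps n) L (sigma t) = 1.
Proof.
move=> /sigma_itv/andP[s0 sL].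
have m0 : 0 < Num.min (sigma t) (L - sigma t) / 2.
  by rewrite divr_gt0// lt_min s0 subr_gt0.
near=> n; apply: dtrunc_id_mid => //.
have : eps n < Num.min (sigma t) (L - sigma t) / 2 by near: n; exact: eps_small.
rewrite ltr_pdivlMr// lt_min => /andP[h1 h2].
by apply/andP; split; lra.
Unshelve. all: by end_near. Qed.

Let dtrunc_right n (t : R) : 2^-1 <= t -> dtrunc_id (eps n) L (sigma t) = 0.
Proof.
move=> h; apply: dtrunc0 => //; right.
by rewrite sigma_right// lerBlDr lerDl ltW.
Qed.

Let cvg_ddual_approx (t : R) : I01 t -> t != 2^-1 ->
  ddual_approx (eps n) t @[n --> \oo] --> dual_d t.
Proof.
rewrite /= in_itv/= => /andP[t0 t1] th; apply: cvg_near_cst.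
move: th; rewrite neq_lt => /orP[h|h].
  have t01 : 0 < t < 2^-1 by rewrite t0 h.
  have r1 : 2^-1 <= 1 - t by lra.
  near=> n; rewrite /ddual_approx /dchi (dtrunc_right n r1) mul0r subr0.
  rewrite (_ : dtrunc_id _ _ _ = 1) ?mul1r /dual_d ?ltW//.
  by near: n; exact: cvg_dtrunc.
have t01 : 2^-1 < t < 1 by rewrite t1 h.
have [e _] := half_not t01.
near=> n; rewrite /ddual_approx /dchi (dtrunc_right n (ltW h)) mul0r sub0r.
rewrite (_ : dtrunc_id _ _ _ = 1) ?mul1r /dual_d ?e//.
by near: n; exact: (cvg_dtrunc (refl t01)).
Unshelve. all: by end_near. Qed.

Lemma measurable_dual (A : set (measurableTypeR R)) : measurable_fun A dual.
Proof. exact: measurable_continuous continuous_dual. Qed.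

Lemma bounded_dual (A : set (measurableTypeR R)) : bounded_on A dual.
Proof. by exists L => x _; have /andP[d0 dL] := dual_range x; rewrite ger0_norm. Qed.

Lemma measurable_dual_d : measurable_fun (I01 : set (measurableTypeR R)) dual_d.
Proof.
apply: measurable_funTS; apply: measurable_fun_ifT => //.
- by apply: (measurable_fun_ler); [exact: measurable_id|exact: measurable_cst].
- by apply: measurable_continuous => t; apply: cvgM; [exact: cvg_cst|exact: cV].
- apply: measurable_continuous => t; apply: cvgN; apply: cvgM; first exact: cvg_cst.
  by apply: continuous_refl; exact: cV.
Qed.

(** The dual field is not a test function: it vanishes only at the ends of
    the interval and has a kink at [1/2].  Truncating its values away from
    its minimum and its maximum removes both defects. *)
Lemma dual_pairing (w : R -> R) (nu : chargeR) :
  leb.-integrable I01 (EFin \o w) -> distributional_derivative w nu ->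
  (\int[leb]_(x in I01) (w x * dual_d x)%:E = - charge_integral nu I01 dual)%E.
Proof.
move=> iw dw; have mI := @measurable_I01 R.
have d1 n : derive1 (dual_approx (eps n)) = ddual_approx (eps n).
  apply/funext => x; rewrite derive1E.
  by apply: (@derive_val _ _ _ _ _ _ _ (is_derive_dual_approx x (eps_gt0 n) (eps_le n))).
have tn n : test_function (dual_approx (eps n)) by exact: test_function_dual_approx.
have mw := measurable_int _ iw.
have c1 : ((\int[leb]_(x in I01) (w x * ddual_approx (eps n) x)%:E)%E @[n --> \oo] -->
    (\int[leb]_(x in I01) (w x * dual_d x)%:E)%E).
  have mn n : measurable_fun (I01 : set (measurableTypeR R))
      (fun x : R => (w x * ddual_approx (eps n) x)%:E).
    apply/measurable_EFinP; apply: measurable_funM; first exact/measurable_EFinP.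
    apply: measurable_continuous => t; apply: cvgB; first exact: continuous_dchi.
    by apply: continuous_refl; exact: continuous_dchi.
  have ml : measurable_fun (I01 : set (measurableTypeR R)) (fun x : R => (w x * dual_d x)%:E).
    apply/measurable_EFinP; apply: measurable_funM; first exact/measurable_EFinP.
    exact: measurable_dual_d.
  have ae : {ae leb, forall x : R, I01 x ->
      (w x * ddual_approx (eps n) x)%:E @[n --> \oo] --> (w x * dual_d x)%:E}.
    exists [set (2^-1 : R)]; split; [exact: measurable_set1|exact: lebesgue_measure_set1|].
    move=> x /= nx; apply: contrapT => xh; apply: nx => Ix.
    apply: cvg_EFin; first exact: nearW.
    by apply: cvgM; [exact: cvg_cst|apply: cvg_ddual_approx => //; exact/eqP].
  have ig : leb.-integrable I01 (EFin \o (fun x : R => `|w x * (2 * (lam * M))|)).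
    have iz : leb.-integrable I01 (EFin \o (fun x : R => w x * (2 * (lam * M)))).
      have := integrableZr mI (2 * (lam * M)) iw.
      by apply: eq_integrable => // x _; rewrite /= EFinM.
    exact: (integrable_norm iz).
  have le : {ae leb, forall (x : R) n, I01 x ->
      (`|(w x * ddual_approx (eps n) x)%:E| <= (`|w x * (2 * (lam * M))|)%:E)%E}.
    apply: aeW => x n _; rewrite /= lee_fin !normrM ler_wpM2l//.
    have := ddual_approx_bound x (eps_gt0 n) (eps_le n).
    by move=> /le_trans; apply; rewrite -!normrM ler_norm.
  by have [_ _] := @dominated_convergence _ (measurableTypeR R) R leb I01 mI _ _ _ mn ml ae ig le.
have c2 : (charge_integral nu I01 (dual_approx (eps n)) @[n --> \oo] -->
    charge_integral nu I01 dual)%E.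
  apply: (@cvg_charge_integral _ (measurableTypeR R) R nu I01 _ _ (L + 9 * L)) => //.
  - by move=> n; apply: measurable_continuous; exact: continuous_test (tn n).
  - exact: measurable_dual.
  - move=> n x _; have := dual_approx_dist x (eps_gt0 n) (eps_le n).
    have /andP[d0 dL] := dual_range x; rewrite !ler_norml => /andP[h1 h2].
    have := eps_le n; have := eps_gt0 n => *; apply/andP; split; lra.
  - exact: bounded_dual.
have c3 : ((\int[leb]_(x in I01) (w x * ddual_approx (eps n) x)%:E)%E @[n --> \oo] -->
    (- charge_integral nu I01 dual)%E).
  have -> : (fun n => (\int[leb]_(x in I01) (w x * ddual_approx (eps n) x)%:E)%E) =
      (fun n => (- charge_integral nu I01 (dual_approx (eps n)))%E).
    by apply/funext => n; rewrite -(dw _ (tn n)) d1.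
  exact: cvgeN.
exact: (cvg_unique _ c1 c3).
Qed.

End Candidate.
(** * The candidate minimizes the energy *)

Section Energy.
Context {R : realType}.
Local Notation leb := (@lebesgue_measure R).
Local Notation I01 := (`]0, 1[%classic : set R).
Local Notation chargeR := (charge (measurableTypeR R) R).

Lemma step_dataE (t : R) : step_data t = if t <= 2^-1 then 0 else 1.
Proof. by rewrite /step_data div1r. Qed.

Lemma measurable_step_data (A : set (measurableTypeR R)) : measurable_fun A (@step_data R).
Proof.
apply: measurable_funTS; apply: measurable_fun_ifT => //.
by apply: measurable_fun_ler; [exact: measurable_id|exact: measurable_cst].
Qed.

Lemma bounded_step_data (A : set (measurableTypeR R)) : bounded_on A (@step_data R).
Proof. by exists 1 => x _; rewrite /step_data; case: ifP; rewrite ?normr0 ?normr1. Qed.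

Lemma bounded_integrable_I01 (h : R -> R) :
  measurable_fun (I01 : set (measurableTypeR R)) h -> bounded_on I01 h ->
  leb.-integrable I01 (EFin \o h).
Proof.
move=> mh bh; apply: bounded_on_integrable => //.
by rewrite [ltLHS]lebesgue_I01 ltry.
Qed.

(** The real numbers [tv] and [c] are the total variation of the singular part
    and its pairing with the dual field: this puts the energy into the form in
    which the calibration argument is arithmetic on real numbers. *)
Lemma energy_terms (m lam : R) (w : R -> R) (dual : R -> R) : 2 < m ->
  BV w -> leb.-integrable I01 (EFin \o (fun t => (w t - step_data t) ^+ 2)) ->
  continuous dual -> (forall t : R, 0 <= dual t <= (m - 1)^-1) ->
  exists (nu : chargeR) (tv c : R),
  [/\ distributional_derivative w nu,
      leb.-integrable I01 (EFin \o ac_density w),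
      K m lam step_data w = (\int[leb]_(t in I01) F m (ac_density w t) + (m - 1)^-1 * tv
        + lam / 2 * \int[leb]_(t in I01) ((w t - step_data t) ^+ 2))%:E,
      charge_integral nu I01 dual =
        (\int[leb]_(t in I01) (dual t * ac_density w t) + c)%:E &
      [/\ tot_var (singular_part w) I01 = tv%:E,
          charge_integral (singular_part w) I01 dual = c%:E & c <= (m - 1)^-1 * tv]].
Proof.
move=> m2 bvw iw2 cdual rdual; have mI := @measurable_I01 R.
have [nu [dnu [ig sing nuE]]] := derivative_pairP bvw.
rewrite -/(ac_density w) -/(singular_part w) in ig sing nuE.
have mdual : measurable_fun (I01 : set (measurableTypeR R)) dual.
  exact: measurable_continuous.
have L0 : 0 <= (m - 1)^-1 by rewrite invr_ge0; lra.
have bdual : bounded_on I01 dual.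
  by exists (m - 1)^-1 => x _; have /andP[d0 dL] := rdual x; rewrite ger0_norm.
have tvE : tot_var (singular_part w) I01 =
    (pos_part (singular_part w) I01 + neg_part (singular_part w) I01)%E by [].
have ftv : tot_var (singular_part w) I01 \is a fin_num.
  by rewrite tvE fin_numD pos_part_fin ?neg_part_fin.
have fc := charge_integral_fin (singular_part w) mI mdual bdual.
exists nu, (fine (tot_var (singular_part w) I01)),
  (fine (charge_integral (singular_part w) I01 dual)).
have iF : leb.-integrable I01 (EFin \o (fun t => F m (ac_density w t))).
  have mF : measurable_fun (I01 : set (measurableTypeR R)) (fun t => F m (ac_density w t)).
    apply: (measurableT_comp (measurable_F m2)).
    by apply/measurable_EFinP; exact: measurable_int ig.
  apply: (@le_integrable _ _ _ leb I01 mI _ (fun t => (m - 1)^-1%:E * (EFin \o ac_density w) t)%E).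
  - exact/measurable_EFinP.
  - move=> t _; rewrite /= lee_fin ger0_norm ?F_ge0// normrM (ger0_norm L0).
    exact: F_le.
  - exact: integrableZl.
have fin h : leb.-integrable I01 (EFin \o h) ->
    (\int[leb]_(t in I01) (h t)%:E)%E = (\int[leb]_(t in I01) h t)%:E.
  by move=> ih; rewrite fineK//; exact: integrable_fin_num.
split=> //.
- by rewrite /K lambda_inftyE// (fin _ iF) (fin _ iw2) -(fineK ftv) -!EFinM -!EFinD.
- rewrite EFinD (fineK fc) -fin; last by apply: integrable_bounded_mul.
  have iI : leb.-integrable setT ((EFin \o ac_density w) \_ I01).
    by apply/(integrable_mkcond _ mI).
  have indE (B : set R) : measurable B -> B `<=` I01 ->
      (induced_charge iI B = \int[leb]_(x in B) (ac_density w x)%:E)%E.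
    move=> mB BI; rewrite /induced_charge; apply: eq_integral => x.
    by rewrite inE => /BI Ix; rewrite patchE mem_set.
  rewrite (@charge_integralD _ _ _ nu (induced_charge iI) (singular_part w))//; last first.
    by move=> B mB BI; rewrite nuE// -indE.
  congr (_ + _)%E; exact: (@charge_integral_density _ _ _ leb).
- split; [by rewrite fineK|by rewrite fineK|].
  rewrite -lee_fin EFinM (fineK fc) (fineK ftv).
  by apply: charge_integral_le_tot_var.
Qed.

End Energy.
Section Comparison.
Context {R : realType}.
Local Notation leb := (@lebesgue_measure R).
Local Notation I01 := (`]0, 1[%classic : set R).
Local Notation f := (@step_data R).

Variables (m lam M : R) (sigma V : R -> R).
Hypotheses (m2 : 2 < m) (lam0 : 0 < lam).
Hypotheses (csigma : continuous sigma) (cV : continuous V).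
Hypothesis sigma_left : forall t : R, t <= 0 -> sigma t = 0.
Hypothesis sigma_right : forall t : R, 2^-1 <= t -> sigma t = (m - 1)^-1.
Hypothesis sigma_itv : forall t : R, 0 < t < 2^-1 -> 0 < sigma t < (m - 1)^-1.
Hypothesis dsigma : forall t : R, 0 < t < 2^-1 -> is_derive t 1 sigma (lam * V t).
Hypothesis dV : forall t : R, 0 < t < 2^-1 -> is_derive t 1 V (inv_slope m (sigma t)).
Hypotheses (VM : forall t : R, 0 < V t <= M) (Mhalf : M < 2^-1).

Let L : R := (m - 1)^-1.
Let q (t : R) : R := inv_slope m (sigma t).
Let v : R -> R := cand V.
Let S : R -> R := dual L sigma.
Let d (t : R) : R := v t - f t.

Let L0 : 0 < L. Proof. by rewrite invr_gt0; have := m2; lra. Qed.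

Let cq (t : R) : 0 < t < 2^-1 -> {for t, continuous q}.
Proof.
move=> t01; have /andP[_ sL] := sigma_itv t01.
apply: (@continuous_comp _ _ _ sigma (inv_slope m)); first exact: csigma.
exact: continuous_inv_slope.
Qed.

Let q_ge0 (t : R) : 0 < t < 2^-1 -> 0 <= q t.
Proof.
by move=> t01; have /andP[s0 sL] := sigma_itv t01; apply: inv_slope_ge0 => //; rewrite ltW.
Qed.

Let S_range (t : R) : 0 <= S t <= L.
Proof. exact: (dual_range L0 sigma_left sigma_right sigma_itv). Qed.

Let S_cont : continuous S.
Proof. exact: continuous_dual. Qed.

Lemma dual_dE (t : R) : dual_d lam V t = lam * d t.
Proof.
rewrite /dual_d /d /v /cand step_dataE; case: ifP => _; first by rewrite subr0.
by ring.
Qed.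

Let mI := @measurable_I01 R.

Let md : measurable_fun (I01 : set (measurableTypeR R)) d.
Proof.
apply: measurable_funB; last exact: measurable_step_data.
by apply/measurable_EFinP; apply: measurable_int (cand_integrable cV).
Qed.

Let bd : bounded_on I01 d.
Proof.
exists M => t _; rewrite /d /v /cand step_dataE; case: ifP => _.
  by have /andP[v0 v1] := VM t; rewrite subr0 gtr0_norm.
have /andP[v0 v1] := VM (1 - t).
by rewrite addrAC subrr add0r normrN gtr0_norm.
Qed.

Let rint (h : R -> R) : R := \int[leb]_(t in I01) h t.

Let E : R := - rint (fun t => fconj m (S t)) - lam * rint (fun t => f t * d t)
  - lam / 2 * rint (fun t => d t ^+ 2).

Let i_conj : leb.-integrable I01 (EFin \o (fun t => fconj m (S t))).
Proof.
apply: continuous_integrable_oo => t.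
by apply: (@continuous_comp _ _ _ S (fconj m)); [exact: S_cont|exact: continuous_conj].
Qed.

Let i_fd : leb.-integrable I01 (EFin \o (fun t => f t * d t)).
Proof.
apply: integrable_bounded_mul => //; first exact: measurable_step_data.
  exact: bounded_step_data.
exact: bounded_integrable_I01.
Qed.

Let i_d2 : leb.-integrable I01 (EFin \o (fun t => d t ^+ 2)).
Proof.
by apply: integrable_bounded_mul => //; exact: bounded_integrable_I01.
Qed.

(** Completing the square turns the pairing with the dual field into the
    distance to the candidate. *)
Lemma square_expansion (w : R -> R) : leb.-integrable I01 (EFin \o w) ->
  leb.-integrable I01 (EFin \o (fun t => (w t - f t) ^+ 2)) ->
  leb.-integrable I01 (EFin \o (fun t => (w t - v t) ^+ 2)) /\
  rint (fun t => (w t - f t) ^+ 2) = rint (fun t => (w t - v t) ^+ 2)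
    + 2 * rint (fun t => d t * w t) - 2 * rint (fun t => f t * d t)
    - rint (fun t => d t ^+ 2).
Proof.
move=> iw iwf.
have idw : leb.-integrable I01 (EFin \o (fun t => d t * w t)).
  exact: integrable_bounded_mul.
have iZ (h : R -> R) : leb.-integrable I01 (EFin \o h) ->
    leb.-integrable I01 (EFin \o (fun t => 2 * h t)).
  by move=> ih; have := integrableZl mI 2 ih; apply: eq_integrable.
have iD (g h : R -> R) : leb.-integrable I01 (EFin \o g) -> leb.-integrable I01 (EFin \o h) ->
    leb.-integrable I01 (EFin \o (fun t => g t + h t)).
  by move=> ig ih; have := integrableD mI ig ih; apply: eq_integrable.
have iB (g h : R -> R) : leb.-integrable I01 (EFin \o g) -> leb.-integrable I01 (EFin \o h) ->
    leb.-integrable I01 (EFin \o (fun t => g t - h t)).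
  by move=> ig ih; have := integrableB mI ig ih; apply: eq_integrable.
have i1 := iB _ _ iwf (iZ _ idw).
have i2 := iD _ _ i1 (iZ _ i_fd).
have i3 := iD _ _ i2 i_d2.
have e : (fun t => (w t - v t) ^+ 2) = (fun t => (w t - f t) ^+ 2 - 2 * (d t * w t)
    + 2 * (f t * d t) + d t ^+ 2).
  by apply/funext => t; rewrite /d; ring.
rewrite e; split=> //.
rewrite /rint RintegralD//.
rewrite RintegralD//; last exact: iZ.
rewrite RintegralB//; last exact: iZ.
by rewrite !RintegralZl//; ring.
Qed.

Let rdual_pairing (w : R -> R) : BV w ->
  leb.-integrable I01 (EFin \o (fun t => (w t - f t) ^+ 2)) ->
  exists tv c : R,
  [/\ leb.-integrable I01 (EFin \o ac_density w),
      K m lam f w = (rint (fun t => F m (ac_density w t)) + L * tv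
        + lam / 2 * rint (fun t => (w t - f t) ^+ 2))%:E,
      lam * rint (fun t => d t * w t) = - (rint (fun t => S t * ac_density w t) + c) &
      [/\ tot_var (singular_part w) I01 = tv%:E,
          charge_integral (singular_part w) I01 S = c%:E & c <= L * tv]].
Proof.
move=> bvw iwf; have iw := proj1 bvw.
have [nu [tv [c [dnu ig KE nuE tvc]]]] := energy_terms lam m2 bvw iwf S_cont S_range.
exists tv, c; split => //.
have := dual_pairing L0 lam0 csigma cV sigma_left sigma_right sigma_itv dsigma VM iw dnu.
have idw : leb.-integrable I01 (EFin \o (fun t => d t * w t)) by exact: integrable_bounded_mul.
have -> : (\int[leb]_(x in I01) (w x * dual_d lam V x)%:E =
    (lam * rint (fun t => d t * w t))%:E)%E.
  rewrite /rint -RintegralZl// /Rintegral fineK; last first.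
    apply: integrable_fin_num => //.
    by have := integrableZl mI lam idw; apply: eq_integrable.
  by apply: eq_integral => x _; rewrite dual_dE; congr EFin; ring.
by rewrite nuE -EFinN => -[].
Qed.

Lemma square_integrable_of_energy (w : R -> R) : BV w -> (K m lam f w < +oo)%E ->
  leb.-integrable I01 (EFin \o (fun t => (w t - f t) ^+ 2)).
Proof.
move=> bvw Kw.
have mwf : measurable_fun (I01 : set (measurableTypeR R)) (fun t => (w t - f t) ^+ 2).
  apply: measurable_funX; apply: measurable_funB; last exact: measurable_step_data.
  by apply/measurable_EFinP; exact: measurable_int (proj1 bvw).
apply/integrableP; split; first exact/measurable_EFinP.
have -> : (\int[leb]_(x in I01) `|(EFin \o (fun t => (w t - f t) ^+ 2)%R) x| =
    \int[leb]_(x in I01) ((w x - f x) ^+ 2)%:E)%E.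
  by apply: eq_integral => x _; rewrite /= ger0_norm ?sqr_ge0.
rewrite ltNge leye_eq; apply/negP => /eqP I3.
move: Kw; rewrite /K I3 gt0_muley ?lte_fin ?divr_gt0// addey ?ltxx//.
apply/negP => /eqP e; have : (0 <= -oo :> \bar R)%E; last by [].
rewrite -e adde_ge0//.
  by apply: integral_ge0 => t _; rewrite lee_fin F_ge0.
by rewrite mule_ge0// lee_fin lambda_inftyE// ltW.
Qed.

(** Fenchel's inequality for the density and the bound of the dual field for
    the singular part, after which the pairing cancels all terms linear in
    [w] except those in the square. *)
Lemma energy_lower_bound (w : R -> R) : BV w -> (K m lam f w < +oo)%E ->
  leb.-integrable I01 (EFin \o (fun t => (w t - v t) ^+ 2)) /\
  ((E + lam / 2 * rint (fun t => (w t - v t) ^+ 2))%:E <= K m lam f w)%E.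
Proof.
move=> bvw Kw; have iwf := square_integrable_of_energy bvw Kw.
have [tv [c [ig -> pair [_ _ ctv]]]] := rdual_pairing bvw iwf.
have [iwv sq] := square_expansion (proj1 bvw) iwf.
split=> //; rewrite lee_fin.
have mS : measurable_fun (I01 : set (measurableTypeR R)) S by exact: measurable_continuous.
have bS : bounded_on I01 S.
  by exists L => x _; have /andP[s0 sL] := S_range x; rewrite ger0_norm.
have iSg : leb.-integrable I01 (EFin \o (fun t => S t * ac_density w t)).
  exact: integrable_bounded_mul.
have iSgc : leb.-integrable I01 (EFin \o (fun t => S t * ac_density w t - fconj m (S t))).
  by have := integrableB mI iSg i_conj; apply: eq_integrable.
have iF : leb.-integrable I01 (EFin \o (fun t => F m (ac_density w t))).
  apply: (@le_integrable _ _ _ leb I01 mI _ (fun t => L%:E * (EFin \o ac_density w) t)%E).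
  - apply/measurable_EFinP; apply: (measurableT_comp (measurable_F m2)).
    by apply/measurable_EFinP; exact: measurable_int ig.
  - move=> t _; rewrite /= lee_fin ger0_norm ?F_ge0// normrM (gtr0_norm L0).
    exact: F_le.
  - exact: integrableZl.
have : rint (fun t => S t * ac_density w t - fconj m (S t)) <= rint (fun t => F m (ac_density w t)).
  apply: le_Rintegral => // t _; apply: fenchel => //; exact: S_range.
rewrite {1}/rint RintegralB// -/(rint _) -/(rint _) => h.
by rewrite /E sq; lra.
Qed.

(** Equality holds in both inequalities of the lower bound: the density of the
    candidate is the inverse slope of its dual field, and its only atom sits
    at the maximum of the dual field. *)
Lemma energy_cand : K m lam f v = E%:E.
Proof.
have bv : BV v by exact: (cand_BV cV dV cq q_ge0 VM Mhalf).
have [tv [c [ig -> pair [tvE cE _]]]] := rdual_pairing bv i_d2.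
have mS : measurable_fun (I01 : set (measurableTypeR R)) S by exact: measurable_continuous.
have bS : bounded_on I01 S.
  by exists L => x _; have /andP[s0 sL] := S_range x; rewrite ger0_norm.
have iSg : leb.-integrable I01 (EFin \o (fun t => S t * ac_density v t)).
  exact: integrable_bounded_mul.
have [aeg sing] := cand_parts cV dV cq q_ge0 VM Mhalf.
have tvg : tv = gap V.
  move: tvE; rewrite (tot_var_singular_cand cV dV cq q_ge0 VM Mhalf).
  by move=> [].
have cg : c = gap V * L.
  move: cE; rewrite (charge_integral_ext mI mS bS sing) gap_charge_integral//.
  by rewrite /S dual_half// => -[].
have rF : rint (fun t => F m (ac_density v t)) =
    rint (fun t => S t * ac_density v t) - rint (fun t => fconj m (S t)).
  rewrite /rint -RintegralB//; congr fine; apply: ae_eq_integral => //.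
  - apply/measurable_EFinP; apply: (measurableT_comp (measurable_F m2)).
    by apply/measurable_EFinP; exact: measurable_int ig.
  - by apply: measurable_int; apply: eq_integrable (integrableB mI iSg i_conj).
  have aeh : {ae leb, forall t : R, t != 2^-1}.
    exists [set (2^-1 : R)]; split; [exact: measurable_set1|exact: lebesgue_measure_set1|].
    by move=> t /= /negP; rewrite negbK => /eqP.
  apply: filterS2 aeg aeh => t + th It => /(_ It)[] ->; congr EFin.
  move: It; rewrite /= in_itv/= => /andP[t0 t1].
  rewrite /cand_d /S dualE//.
  move: th; rewrite neq_lt => /orP[h|h].
    rewrite h ltW//; apply: fenchel_eq => //.
    by have /andP[s0 sL] := sigma_itv (introT andP (conj t0 h)); rewrite ltW.
  rewrite ltNge (ltW h)/= leNgt h/=; apply: fenchel_eq => //.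
  have t01 : 0 < 1 - t < 2^-1 by lra.
  by have /andP[s0 sL] := sigma_itv t01; rewrite ltW.
have [_ sq] := square_expansion (proj1 bv) i_d2.
have r0 : rint (fun t => (v t - v t) ^+ 2) = 0.
  rewrite /rint (@eq_Rintegral _ _ _ _ _ (cst 0)); last by move=> t _; rewrite subrr expr0n.
  by rewrite Rintegral_cst// mul0r.
move: sq; rewrite r0 -/(rint (fun t => d t ^+ 2)) => sq.
by congr EFin; rewrite rF tvg /E; move: pair; rewrite cg; nra.
Qed.

Lemma minimizer_cand (u : R -> R) : minimizer m lam f u ->
  ae_eq leb I01 (EFin \o u) (EFin \o v).
Proof.
move=> [bvu umin].
have bv : BV v by exact: (cand_BV cV dV cq q_ge0 VM Mhalf).
have := umin v bv; rewrite energy_cand => Ku.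
have [iuv] := energy_lower_bound bvu (le_lt_trans Ku (ltry _)).
move=> /le_trans/(_ Ku); rewrite lee_fin gerDl pmulr_rle0 ?divr_gt0// => r_le0.
have mh := measurable_int _ iuv.
have /(ae_eq_integral_abs leb mI mh) : (\int[leb]_(x in I01)
    `|(EFin \o (fun t => (u t - v t) ^+ 2)%R) x| = 0)%E.
  have -> : (\int[leb]_(x in I01) `|(EFin \o (fun t => (u t - v t) ^+ 2)%R) x| =
      \int[leb]_(x in I01) ((u x - v x) ^+ 2)%:E)%E.
    by apply: eq_integral => x _; rewrite /= ger0_norm ?sqr_ge0.
  rewrite -[LHS]fineK; last exact: integrable_fin_num.
  congr EFin; apply/eqP; rewrite eq_le r_le0/=.
  by apply: Rintegral_ge0 => t _; exact: sqr_ge0.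
apply: filterS => t h It; move: (h It) => [] /eqP.
by rewrite sqrf_eq0 subr_eq0 => /eqP e; rewrite /= e.
Qed.

End Comparison.
(** * One-sided limits of the good representative *)

Section Conclusion.
Context {R : realType}.
Local Notation leb := (@lebesgue_measure R).
Local Notation I01 := (`]0, 1[%classic : set R).

Lemma ae_meets_interval (u v : R -> R) (a b : R) :
  ae_eq leb I01 (EFin \o u) (EFin \o v) -> 0 <= a -> a < b -> b <= 1 ->
  exists x : R, a < x < b /\ u x = v x.
Proof.
move=> [N [mN N0 subN]] a0 ab b1; apply: contrapT => h.
have : (leb `]a, b[%classic <= leb N)%E.
  apply: le_measure; rewrite ?inE//.
  move=> x; rewrite /= in_itv/= => xab; apply: subN => /= e; apply: h; exists x.
  split=> //; have /e[//] : I01 x.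
  by rewrite /= in_itv/=; lra.
by rewrite N0 lebesgue_measure_itv/= lte_fin ab -EFinB lee_fin; lra.
Qed.

(** An equality almost everywhere only gives agreement at some points of each
    neighbourhood; this suffices once the limit is known to exist. *)
Lemma limit_meets (G : set_system R) {FG : ProperFilter G} (u g : R -> R) (c : R) :
  cvg (u x @[x --> G]) -> g x @[x --> G] --> c ->
  (forall A : set R, G A -> exists2 x, A x & u x = g x) -> u x @[x --> G] --> c.
Proof.
move=> cu cg meets; set l := lim (u x @[x --> G]).
suff <- : l = c by exact: cu.
apply/eqP; rewrite -subr_eq0 -normr_le0; apply/ler_addgt0Pl => e e0; rewrite addr0.
have e2 : 0 < e / 2 by rewrite divr_gt0.
have /cvgrPdist_lt/(_ _ e2) h1 : u x @[x --> G] --> l by exact: cu.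
have /cvgrPdist_lt/(_ _ e2) h2 := cg.
have [x [a1 a2] xe] := meets _ (filterI h1 h2).
rewrite (_ : l - c = (l - u x) - (c - g x)); last by rewrite xe; ring.
by rewrite (le_trans (ler_normB _ _))// [leRHS]splitr lerD// ltW.
Qed.

Lemma right_limit (u v g : R -> R) (t b : R) :
  ae_eq leb I01 (EFin \o u) (EFin \o v) -> continuous g -> 0 <= t -> t < b -> b <= 1 ->
  (forall x, t < x < b -> v x = g x) -> cvg (u x @[x --> t^'+]) ->
  u x @[x --> t^'+] --> g t.
Proof.
move=> uv cg t0 tb b1 vg cu; apply: (limit_meets cu).
  by apply: cvg_at_right_filter; exact: cg.
move=> A [e /= e0 eA].
have [|||x [/andP[tx xe] ux]] := @ae_meets_interval u v t (Num.min b (t + e)) uv.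
- exact: t0.
- by rewrite lt_min tb ltrDl.
- by rewrite ge_min b1.
move: xe; rewrite lt_min => /andP[xb xte].
exists x; last by rewrite ux vg// tx xb.
by apply: eA => //=; rewrite ltr0_norm ?subr_lt0// opprB ltrBlDl.
Qed.

Lemma left_limit (u v g : R -> R) (t a : R) :
  ae_eq leb I01 (EFin \o u) (EFin \o v) -> continuous g -> 0 <= a -> a < t -> t <= 1 ->
  (forall x, a < x < t -> v x = g x) -> cvg (u x @[x --> t^'-]) ->
  u x @[x --> t^'-] --> g t.
Proof.
move=> uv cg a0 at0 t1 vg cu; apply: (limit_meets cu).
  by apply: cvg_at_left_filter; exact: cg.
move=> A [e /= e0 eA].
have [|||x [/andP[tx xe] ux]] := @ae_meets_interval u v (Num.max a (t - e)) t uv.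
- by rewrite le_max a0.
- by rewrite gt_max at0 ltrBlDr ltrDl.
- exact: t1.
move: tx; rewrite gt_max => /andP[ax xte].
exists x; last by rewrite ux vg// ax xe.
by apply: eA => //=; rewrite gtr0_norm ?subr_gt0// ltrBlDr addrC -ltrBlDr.
Qed.

Lemma right_within (u : R -> R) (t l : R) : 0 <= t < 1 ->
  u x @[x --> within `[0, 1] (nbhs t)] --> l -> u x @[x --> t^'+] --> l.
Proof.
move=> /andP[t0 t1]; apply: cvg_trans; apply: cvg_app.
move=> A [e /= e0 eA]; have m0 : 0 < Num.min e (1 - t) by rewrite lt_min e0 subr_gt0.
exists (Num.min e (1 - t)) => //= x xe tx; apply: eA => /=.
  by apply: (lt_le_trans xe); rewrite ge_min lexx.
have : `|t - x| < 1 - t by apply: (lt_le_trans xe); rewrite ge_min lexx orbT.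
rewrite distrC gtr0_norm ?subr_gt0// in_itv/= => h.
by apply/andP; split; lra.
Qed.

Lemma left_within (u : R -> R) (t l : R) : 0 < t <= 1 ->
  u x @[x --> within `[0, 1] (nbhs t)] --> l -> u x @[x --> t^'-] --> l.
Proof.
move=> /andP[t0 t1]; apply: cvg_trans; apply: cvg_app.
move=> A [e /= e0 eA]; have m0 : 0 < Num.min e t by rewrite lt_min e0.
exists (Num.min e t) => //= x xe tx; apply: eA => /=.
  by apply: (lt_le_trans xe); rewrite ge_min lexx.
have : `|t - x| < t by apply: (lt_le_trans xe); rewrite ge_min lexx orbT.
rewrite gtr0_norm ?subr_gt0// in_itv/= => h.
by apply/andP; split; lra.
Qed.

Variables (V : R -> R) (M : R) (u : R -> R).
Hypotheses (cV : continuous V) (VM : forall t : R, 0 < V t <= M) (Mhalf : M < 2^-1).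
Hypothesis uv : ae_eq leb I01 (EFin \o u) (EFin \o cand V).
Hypothesis rep : good_representative u.

Let V2 (x : R) : R := 1 - V (1 - x).

Let cV2 : continuous V2.
Proof.
move=> t; apply: cvgB; first exact: cvg_cst.
apply: (@continuous_comp _ _ _ (fun x : R => 1 - x) V); last exact: cV.
by apply: cvgB; [exact: cvg_cst|exact: cvg_id].
Qed.

Let candL (x : R) : x < 2^-1 -> cand V x = V x.
Proof. by move=> h; rewrite /cand ltW. Qed.

Let candR (x : R) : 2^-1 < x -> cand V x = V2 x.
Proof. by move=> h; rewrite /cand leNgt h. Qed.

Lemma left_half_right_limit (t : R) : 0 <= t < 2^-1 -> u x @[x --> t^'+] --> V t.
Proof.
move=> /andP[t0 t1]; have h1 := @half_lt1 R; have [rr _ _ _] := rep.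
apply: (right_limit uv cV t0 t1 (ltW h1)); last by apply: rr; lra.
by move=> x /andP[_ xh]; exact: candL.
Qed.

Lemma left_half_left_limit (t : R) : 0 < t <= 2^-1 -> u x @[x --> t^'-] --> V t.
Proof.
move=> /andP[t0 t1]; have h1 := @half_lt1 R; have [_ rl _ _] := rep.
have t1' : t <= 1 by lra.
apply: (left_limit uv cV (lexx 0) t0 t1'); last by apply: rl; lra.
by move=> x /andP[_ xh]; apply: candL; lra.
Qed.

Lemma right_half_right_limit (t : R) : 2^-1 <= t < 1 -> u x @[x --> t^'+] --> V2 t.
Proof.
move=> /andP[t0 t1]; have h0 := @half_gt0 R; have [rr _ _ _] := rep.
have t0' : 0 <= t by lra.
apply: (right_limit uv cV2 t0' t1 (lexx 1)); last by apply: rr; lra.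
by move=> x /andP[xh _]; apply: candR; lra.
Qed.

Lemma right_half_left_limit (t : R) : 2^-1 < t <= 1 -> u x @[x --> t^'-] --> V2 t.
Proof.
move=> /andP[t0 t1]; have h0 := @half_gt0 R; have [_ rl _ _] := rep.
apply: (left_limit uv cV2 (ltW h0) t0 t1); last by apply: rl; lra.
by move=> x /andP[xh _]; exact: candR.
Qed.

(** Both one-sided limits are the value of the continuous function [V], so there
    is no jump and the representative is continuous there. *)
Lemma good_representative_left (t : R) : 0 <= t < 2^-1 -> u t = V t.
Proof.
move=> t01; have /andP[t0 t1] := t01; have h1 := @half_lt1 R.
have rlim := left_half_right_limit t01.
have [_ _ _ cont] := rep.
have nj : ~ jump u t.
  move=> [/andP[tp _] _ _]; apply.
  have t01' : 0 < t <= 2^-1 by rewrite tp ltW.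
  have llim := left_half_left_limit t01'.
  by rewrite (cvg_lim _ llim)// (cvg_lim _ rlim).
have t01' : 0 <= t <= 1 by lra.
have t01'' : 0 <= t < 1 by lra.
exact: (cvg_unique _ (right_within t01'' (cont t t01' nj)) rlim).
Qed.

Lemma good_representative_right (t : R) : 2^-1 < t <= 1 -> u t = V2 t.
Proof.
move=> t01; have /andP[t0 t1] := t01; have h0 := @half_gt0 R.
have llim := right_half_left_limit t01.
have [_ _ _ cont] := rep.
have nj : ~ jump u t.
  move=> [/andP[_ tp] _ _]; apply.
  have t01' : 2^-1 <= t < 1 by rewrite tp ltW.
  have rlim := right_half_right_limit t01'.
  by rewrite (cvg_lim _ llim)// (cvg_lim _ rlim).
have t01' : 0 <= t <= 1 by lra.
have t01'' : 0 < t <= 1 by lra.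
exact: (cvg_unique _ (left_within t01'' (cont t t01' nj)) llim).
Qed.

Lemma jump_half : jump u 2^-1.
Proof.
have h0 := @half_gt0 R; have h1 := @half_lt1 R.
have hl : (0 < (2^-1 : R)) && ((2^-1 : R) <= 2^-1) by rewrite h0 lexx.
have hr : ((2^-1 : R) <= 2^-1) && ((2^-1 : R) < 1) by rewrite h1 lexx.
have ll := left_half_left_limit hl; have rl := right_half_right_limit hr.
split; [by rewrite h0 h1|by apply/cvg_ex; exists (V 2^-1)|by apply/cvg_ex; exists (V2 2^-1)|].
rewrite (cvg_lim _ ll)// (cvg_lim _ rl)// /V2.
by have /andP[_ a] := VM 2^-1; have /andP[_ b] := VM (1 - 2^-1); have := Mhalf; lra.
Qed.

End Conclusion.

Theorem theorem1p4 (R : realType) (mu lam : R) (u : R -> R)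
  (hmu : 1 < mu) (hlam : 0 < lam)
  (hmin : minimizer mu lam step_data u)
  (hrep : good_representative u)
  (hmu2 : 2 < mu) (hlam8 : 8 / (mu - 2) < lam) :
  [/\ (ereal_sup [set (u t)%:E | t in [set t : R | (0 <= t < 1 / 2)%R]]
         < (1 / 2)%:E)%E,
      ((1 / 2)%:E
         < ereal_inf [set (u t)%:E | t in [set t : R | (1 / 2 < t <= 1)%R]])%E
    & jump u (1 / 2)].
Proof.
have lam0 := hlam.
have half : (1 / 2 : R) = 2^-1 by rewrite div1r.
have [sigma [V [M [csigma cV [sl sr] sitv [dsigma dV VM Mhalf]]]]] := profile hmu2 hlam8.
have uv : ae_eq (@lebesgue_measure R) (`]0, 1[%classic : set R) (EFin \o u) (EFin \o cand V).
  exact: (minimizer_cand hmu2 lam0 csigma cV sl sr sitv dsigma dV VM Mhalf hmin).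
split.
- apply: (@le_lt_trans _ _ M%:E); last by rewrite lte_fin half.
  apply: ge_ereal_sup => _ [t t01 <-]; rewrite lee_fin.
  move: t01; rewrite /= half => /(good_representative_left cV uv hrep) ->.
  by have /andP[] := VM t.
- apply: (@lt_le_trans _ _ (1 - M)%:E); first by rewrite lte_fin half; lra.
  apply: le_ereal_inf_tmp => _ [t t01 <-]; rewrite lee_fin.
  move: t01; rewrite /= half => /(good_representative_right cV uv hrep) ->.
  by have /andP[_ h] := VM (1 - t); lra.
- by rewrite half; exact: (jump_half cV VM Mhalf uv hrep).
Qed.
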